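(* Let $\mathcal R$ be a commutative unital ring and $k\geqslant 1$. For each $n\geqslant 0$, the ($\mathcal R$-linearly extended) combing map $\mathsf E\colon \mathcal R\mathcal P_k\to\mathcal R\Pi_k$ induces a bijection between the $n$-th powers of the augmentation ideals: $$\mathsf E(J^n\mathcal P_k)=J^n\Pi_k .$$
   Context: For a group $G$, the augmentation ideal $JG$ is the kernel of the augmentation homomorphism $\mathcal R G\to\mathcal R$ sending every $g\in G$ to $1$; $J^nG$ is its $n$-th power, with $J^0G=\mathcal RG$. $\mathcal P_k$ is the pure braid group on $k$ strands; the product $\alpha\beta$ means ''$\alpha$ on top of $\beta$''. For $1\leqslant i\leqslant k-1$, $F_i\subset \mathcal P_k$ is the subgroup of pure braids that can be drawn so that all strands other than the $(i+1)$-st are vertical and straight, while the $(i+1)$-st strand braids around the $i$ strands to its left. It is free of rank $i$. (It is the kernel of the homomorphism $\mathcal P_{i+1}\to\mathcal P_i$ forgetting the last strand, viewed in $\mathcal P_k$ by adding $k-i-1$ vertical non-interacting strands on the right.) One has the iterated semidirect product decomposition $\mathcal P_k\cong F_{k-1}\ltimes\cdots\ltimes F_2\ltimes F_1$, so every pure braid $\beta\in\mathcal P_k$ can be uniquely written as $\beta=\beta_{k-1}\beta_{k-2}\cdots\beta_1$ with $\beta_i\in F_i$ (Artin's combing). $\Pi_k:=F_{k-1}\times\cdots\times F_1$ is the direct product of groups. The combing map $\mathsf E\colon\mathcal P_k\to\Pi_k$ is the bijection of sets $\beta_{k-1}\beta_{k-2}\cdots\beta_1\mapsto(\beta_{k-1},\beta_{k-2},\dots,\beta_1)$.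 The same letter denotes its $\mathcal R$-linear extension $\mathsf E\colon\mathcal R\mathcal P_k\to\mathcal R\Pi_k$, which is an isomorphism of $\mathcal R$-modules (not a ring homomorphism in general). *)

(* Defs.v *)
From HB Require Import structures.
From mathcomp Require Import all_boot all_algebra finmap zify.
From mathcomp Require Import boolp classical_sets functions.
From mathcomp.multinomials Require Import xfinmap monalg.

Set Implicit Arguments.
Unset Strict Implicit.
Unset Printing Implicit Defensive.

Import GRing.Theory BigEnoughFSet.

Local Open Scope classical_set_scope.
Local Open Scope ring_scope.

(* [{malg R[G]}] only carries a product when [G] is a [monomType], which excludes
   nontrivial groups; the convolution product is therefore set up here.  The zero
   ring is allowed as [R]. *)
Definition group_ring (R : pzRingType) (G : groupType) : Type := {malg R[G]}.

Section GroupRing.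
Variables (R : pzRingType) (G : groupType).
Local Notation RG := (group_ring R G).
Implicit Types (x y z : RG) (g h : G).

HB.instance Definition _ := GRing.Zmodule.copy RG {malg R[G]}.

Definition gr_one : RG := << 1 *g 1%g >>.
Definition gr_mul x y : RG :=
  \sum_(g <- msupp x) \sum_(h <- msupp y) << x@_g * y@_h *g (g * h)%g >>.

Lemma gr_mulEw (d1 d2 : {fset G}) x y : (msupp x `<=` d1)%fset ->
  (msupp y `<=` d2)%fset -> gr_mul x y =
  \sum_(g <- d1) \sum_(h <- d2) << x@_g * y@_h *g (g * h)%g >>.
Proof.
move=> le1 le2; rewrite /gr_mul (big_fset_incl _ le1) /=.
  apply/eq_bigr=> g _; apply/big_fset_incl => // h _ /mcoeff_outdom ->.
  by rewrite mulr0 monalgU0.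
move=> g _ /mcoeff_outdom xg.
by rewrite big1 => // h _; rewrite xg mul0r monalgU0.
Qed.

Lemma gr_mulUU c1 c2 g h :
  gr_mul << c1 *g g >> << c2 *g h >> = << c1 * c2 *g (g * h)%g >>.
Proof. by rewrite (gr_mulEw msuppU_le msuppU_le) !big_seq_fset1 !mcoeffUU. Qed.

Lemma gr_mulDl : left_distributive gr_mul +%R.
Proof.
move=> x y z; pose_big_fset G E; rewrite 3?(gr_mulEw (d1 := E) (d2 := E)) //; last by close.
rewrite -big_split /=; apply/eq_bigr=> g _.
rewrite -big_split /=; apply/eq_bigr=> h _.
by rewrite mcoeffD mulrDl monalgUD.
Qed.

Lemma gr_mulDr : right_distributive gr_mul +%R.
Proof.
move=> x y z; pose_big_fset G E; rewrite 3?(gr_mulEw (d1 := E) (d2 := E)) //; last by close.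
rewrite -big_split /=; apply/eq_bigr=> g _.
rewrite -big_split /=; apply/eq_bigr=> h _.
by rewrite mcoeffD mulrDr monalgUD.
Qed.

Lemma gr_mul0l x : gr_mul 0 x = 0.
Proof. by apply: (addrI (gr_mul 0 x)); rewrite -gr_mulDl !addr0. Qed.

Lemma gr_mul0r x : gr_mul x 0 = 0.
Proof. by apply: (addrI (gr_mul x 0)); rewrite -gr_mulDr !addr0. Qed.

Lemma gr_mul_suml I (r : seq I) (F : I -> RG) y :
  gr_mul (\sum_(i <- r) F i) y = \sum_(i <- r) gr_mul (F i) y.
Proof.
exact: (big_morph (gr_mul^~ y) (fun a b => gr_mulDl a b y) (gr_mul0l y)).
Qed.

Lemma gr_mul_sumr I (r : seq I) (F : I -> RG) x :
  gr_mul x (\sum_(i <- r) F i) = \sum_(i <- r) gr_mul x (F i).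
Proof.
exact: (big_morph (gr_mul x) (gr_mulDr x) (gr_mul0r x)).
Qed.

Lemma gr_mulEl x y : gr_mul x y = \sum_(g <- msupp x) gr_mul << x@_g *g g >> y.
Proof. by rewrite [in LHS](monalgE x) gr_mul_suml. Qed.

Lemma gr_mulEr x y : gr_mul x y = \sum_(g <- msupp y) gr_mul x << y@_g *g g >>.
Proof. by rewrite [in LHS](monalgE y) gr_mul_sumr. Qed.

Lemma gr_mulA : associative gr_mul.
Proof.
move=> x y z; rewrite (gr_mulEl x y) gr_mul_suml (gr_mulEl x).
apply: eq_bigr => g _; move: (x@_g) => c; clear x.
rewrite (gr_mulEl y z) (gr_mulEr _ y) gr_mul_suml gr_mul_sumr.
apply: eq_bigr => h _; move: (y@_h) => d; clear y.
rewrite (gr_mulEr _ z) [RHS](gr_mulEr _ z) gr_mul_sumr.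
by apply: eq_bigr => k _; rewrite !gr_mulUU mulrA mulgA.
Qed.

Lemma gr_mul1l : left_id gr_one gr_mul.
Proof.
move=> x; rewrite [in LHS](monalgE x) gr_mul_sumr [RHS](monalgE x).
by apply: eq_bigr => g _; rewrite gr_mulUU mul1r mul1g.
Qed.

Lemma gr_mul1r : right_id gr_one gr_mul.
Proof.
move=> x; rewrite [in LHS](monalgE x) gr_mul_suml [RHS](monalgE x).
by apply: eq_bigr => g _; rewrite gr_mulUU mulr1 mulg1.
Qed.

HB.instance Definition _ := GRing.Zmodule_isPzRing.Build RG
  gr_mulA gr_mul1l gr_mul1r gr_mulDl gr_mulDr.

Definition augmentation x : R := \sum_(g <- msupp x) x@_g.

Lemma augmentationEw (d : {fset G}) x : (msupp x `<=` d)%fset ->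
  augmentation x = \sum_(g <- d) x@_g.
Proof. by move=> le; apply: big_fset_incl => // g _ /mcoeff_outdom ->. Qed.

Lemma augmentationU c g : augmentation << c *g g >> = c.
Proof. by rewrite (augmentationEw msuppU_le) big_seq_fset1 mcoeffUU. Qed.

Fact augmentation_is_zmod_morphism : zmod_morphism augmentation.
Proof.
move=> x y; pose_big_fset G E; rewrite 3?(augmentationEw (d := E)) //; last by close.
by rewrite -sumrB; apply: eq_bigr => g _; rewrite mcoeffB.
Qed.
HB.instance Definition _ :=
  GRing.isZmodMorphism.Build RG R augmentation augmentation_is_zmod_morphism.

Fact augmentation_is_monoid_morphism : monoid_morphism augmentation.
Proof.
split=> [|x y]; first exact: augmentationU.
rewrite [LHS]raddf_sum mulr_suml; apply: eq_bigr => g _ /=.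
rewrite raddf_sum mulr_sumr; apply: eq_bigr => h _ /=.
exact: augmentationU.
Qed.
HB.instance Definition _ :=
  GRing.isMonoidMorphism.Build RG R augmentation augmentation_is_monoid_morphism.

Definition augmentation_ideal : set RG := [set x | augmentation x = 0].

End GroupRing.

Section IdealPower.
Variable A : pzRingType.

Definition ideal_mul (I J : set A) : set A :=
  [set x | exists s : seq (A * A),
     (forall p, p \in s -> I p.1 /\ J p.2) /\ x = \sum_(p <- s) p.1 * p.2].

Fixpoint ideal_exp (I : set A) (n : nat) : set A :=
  if n is n'.+1 then ideal_mul I (ideal_exp I n') else setT.

End IdealPower.

Definition augmentation_power (R : pzRingType) (G : groupType) (n : nat) :
  set (group_ring R G) := ideal_exp (@augmentation_ideal R G) n.
Arguments augmentation_power R G n : clear implicits.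

Definition linear_extension (R : pzRingType) (G H : groupType) (f : G -> H)
  (x : group_ring R G) : group_ring R H := \sum_(g <- msupp x) << x@_g *g f g >>.
Arguments linear_extension R {G H} f x.

(* Strand positions are numbered 0, ..., k-1 from left to right.  The letter
   [(i, true)] is the Artin generator crossing positions i and i+1, [(i, false)]
   is its inverse, and words are read from top to bottom, so that concatenation
   puts the first braid on top of the second. *)
Notation braid_word k := (seq ('I_k.-1 * bool)).

Inductive braid_equiv (k : nat) : braid_word k -> braid_word k -> Prop :=
| BraidRefl u : braid_equiv u u
| BraidSym u v : braid_equiv u v -> braid_equiv v u
| BraidTrans u v w : braid_equiv u v -> braid_equiv v w -> braid_equiv u w
| BraidCat u u' v v' :
    braid_equiv u u' -> braid_equiv v v' -> braid_equiv (u ++ v) (u' ++ v')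
| BraidCancel i b : braid_equiv [:: (i, b); (i, ~~ b)] [::]
| BraidFar (i j : 'I_k.-1) : (i.+1 < j)%N ->
    braid_equiv [:: (i, true); (j, true)] [:: (j, true); (i, true)]
| BraidArtin (i j : 'I_k.-1) : j = i.+1 :> nat ->
    braid_equiv [:: (i, true); (j, true); (i, true)]
                [:: (j, true); (i, true); (j, true)].

Section Strands.
Local Open Scope nat_scope.

Definition cross (i p : nat) : nat :=
  if p == i then i.+1 else if p == i.+1 then i else p.

Definition strand_end k (w : braid_word k) (p : nat) : nat :=
  foldl (fun q l => cross (val l.1) q) p w.

Fixpoint only_moves k (p : nat) (w : braid_word k) : bool :=
  if w is l :: w' then
    ((p == val l.1) || (p == (val l.1).+1)) && only_moves (cross (val l.1) p) w'
  else true.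

Lemma crossK i : involutive (cross i).
Proof.
move=> p; rewrite /cross; case: (eqVneq p i) => [->|pi].
  by rewrite eqxx -(addn1 i) -[X in _ == X]addn0 eqn_add2l.
by case: (eqVneq p i.+1) => [->|pi1]; rewrite ?eqxx // (negPf pi) (negPf pi1).
Qed.

Lemma strand_end_cat k (u v : braid_word k) p :
  strand_end (u ++ v) p = strand_end v (strand_end u p).
Proof. by rewrite /strand_end foldl_cat. Qed.

Lemma only_moves_cat k (u v : braid_word k) p :
  only_moves p (u ++ v) = only_moves p u && only_moves (strand_end u p) v.
Proof. by elim: u p => //= l u IH p; rewrite IH andbA. Qed.

Definition word_inv k (w : braid_word k) : braid_word k :=
  rev [seq (l.1, ~~ l.2) | l <- w].

Lemma strand_endK k (w : braid_word k) p :
  strand_end (word_inv w) (strand_end w p) = p.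
Proof.
elim: w p => //= l w IH p.
by rewrite /word_inv /= rev_cons -cats1 strand_end_cat IH /strand_end /= crossK.
Qed.

Lemma only_moves_inv k (w : braid_word k) p :
  only_moves p w -> only_moves (strand_end w p) (word_inv w).
Proof.
elim: w p => //= l w IH p /andP[lp wp].
rewrite /word_inv /= rev_cons -cats1 only_moves_cat IH //= strand_endK andbT.
by rewrite /cross; move: lp; case: eqP => [_|_ /= ->]; rewrite eqxx ?orbT.
Qed.

Lemma strand_end_equiv k (u v : braid_word k) : braid_equiv u v ->
  strand_end u =1 strand_end v.
Proof.
elim=> {u v} //.
- by move=> u v _ H p; rewrite H.
- by move=> u v w _ H1 _ H2 p; rewrite H1.
- by move=> u u' v v' _ H1 _ H2 p; rewrite !strand_end_cat H1 H2.
- by move=> i b p; rewrite /strand_end /= crossK.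
- move=> i j ij p; rewrite /strand_end /cross /=; move: ij.
  by repeat case: eqP => //=; lia.
- move=> i j ij p; rewrite /strand_end /cross /= ij.
  by repeat case: eqP => //=; lia.
Qed.

End Strands.

Lemma word_invK k : involutive (@word_inv k).
Proof.
move=> w; rewrite /word_inv map_rev revK -map_comp.
by rewrite -[RHS]map_id; apply: eq_map => -[i b] /=; rewrite negbK.
Qed.

Lemma word_inv_cat k (u v : braid_word k) :
  word_inv (u ++ v) = word_inv v ++ word_inv u.
Proof. by rewrite /word_inv map_cat rev_cat. Qed.

Lemma word_invV k (w : braid_word k) : braid_equiv (w ++ word_inv w) [::].
Proof.
elim: w => [|[i b] w IH]; first exact: BraidRefl.
rewrite -cat1s word_inv_cat !catA -(catA [:: (i, b)]).
apply: BraidTrans (BraidCancel i b).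
rewrite -[X in braid_equiv _ X](cats0) -[[:: _; _] ++ [::]]/([:: (i, b)] ++ [:: (i, ~~ b)]).
apply: BraidCat; last exact: BraidRefl.
by rewrite -[X in braid_equiv _ X]cats0; apply: BraidCat IH; exact: BraidRefl.
Qed.

Lemma word_inv_equiv k (u v : braid_word k) :
  braid_equiv u v -> braid_equiv (word_inv u) (word_inv v).
Proof.
move=> uv.
have cat0 w : w = w ++ [::] :> braid_word k by rewrite cats0.
apply: (@BraidTrans _ _ (word_inv u ++ (v ++ word_inv v))).
  rewrite [X in braid_equiv X _]cat0; apply: BraidCat; first exact: BraidRefl.
  exact/BraidSym/word_invV.
apply: (@BraidTrans _ _ (word_inv u ++ (u ++ word_inv v))).
  apply: BraidCat; first exact: BraidRefl.
  by apply: BraidCat; [exact: BraidSym | exact: BraidRefl].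
rewrite catA; rewrite -[X in braid_equiv _ X]cat0s.
apply: BraidCat; last exact: BraidRefl.
by rewrite -{2}(word_invK u); exact: word_invV.
Qed.

Section BraidGroup.
Variable k : nat.

Definition braid_rel : rel (braid_word k) := [rel u v | `[< braid_equiv u v >]].

Fact braid_rel_refl : reflexive braid_rel.
Proof. by move=> u; apply/asboolP; exact: BraidRefl. Qed.
Fact braid_rel_sym : symmetric braid_rel.
Proof. by move=> u v; apply/asboolP/asboolP; exact: BraidSym. Qed.
Fact braid_rel_trans : transitive braid_rel.
Proof.
move=> v u w /asboolP uv /asboolP vw; apply/asboolP; exact: BraidTrans uv vw.
Qed.
Canonical braid_equiv_rel :=
  EquivRel braid_rel braid_rel_refl braid_rel_sym braid_rel_trans.

Definition braid := {eq_quot braid_equiv_rel}%qT.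
HB.instance Definition _ := Choice.on braid.

Definition braid_class (w : braid_word k) : braid := \pi_(braid)%qT w.

Lemma braid_classP u v : braid_class u = braid_class v <-> braid_equiv u v.
Proof. by split=> [/eqmodP /asboolP|uv] //; apply/eqmodP/asboolP. Qed.

Lemma braid_classK (b : braid) : braid_class (repr b) = b.
Proof. exact: reprK. Qed.

Lemma repr_braid_class w : braid_equiv (repr (braid_class w)) w.
Proof. by apply/braid_classP; rewrite braid_classK. Qed.

Definition braid_mul (a b : braid) : braid := braid_class (repr a ++ repr b).
Definition braid_inv (a : braid) : braid := braid_class (word_inv (repr a)).

Lemma braid_mulE u v :
  braid_mul (braid_class u) (braid_class v) = braid_class (u ++ v).
Proof. by apply/braid_classP/BraidCat; exact: repr_braid_class. Qed.

Lemma braid_invE u : braid_inv (braid_class u) = braid_class (word_inv u).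
Proof. by apply/braid_classP/word_inv_equiv/repr_braid_class. Qed.

Fact braid_mulA : associative braid_mul.
Proof.
move=> a b c; rewrite -(braid_classK a) -(braid_classK b) -(braid_classK c).
by rewrite !braid_mulE catA.
Qed.
Fact braid_mul1 : left_id (braid_class [::]) braid_mul.
Proof. by move=> a; rewrite -(braid_classK a) braid_mulE. Qed.
Fact braid_mulr1 : right_id (braid_class [::]) braid_mul.
Proof. by move=> a; rewrite -(braid_classK a) braid_mulE cats0. Qed.
Fact braid_mulV : right_inverse (braid_class [::]) braid_inv braid_mul.
Proof.
move=> a; rewrite -(braid_classK a) braid_invE braid_mulE.
exact/braid_classP/word_invV.
Qed.
Fact braid_mulVl : left_inverse (braid_class [::]) braid_inv braid_mul.
Proof.
move=> a; rewrite -(braid_classK a) braid_invE braid_mulE.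
by apply/braid_classP; rewrite -{2}(word_invK (repr a)); exact: word_invV.
Qed.

HB.instance Definition _ := isGroup.Build braid
  braid_mulA braid_mul1 braid_mulr1 braid_mulVl braid_mulV.

Definition is_pure : {pred braid} :=
  fun b => [forall p : 'I_k, strand_end (repr b) p == p].

Lemma is_pureP w :
  reflect (forall p : 'I_k, strand_end w p = p) (braid_class w \in is_pure).
Proof.
apply: (iffP forallP) => H p; have E := strand_end_equiv (repr_braid_class w).
  by rewrite -E; exact/eqP.
by rewrite E H.
Qed.

Fact is_pure_group_closed : group_closed is_pure.
Proof.
split=> [|a b]; first exact/is_pureP.
rewrite -(braid_classK a) -(braid_classK b) => /is_pureP Ha /is_pureP Hb.
rewrite [(_^-1)%g]braid_invE [(_ * _)%g]braid_mulE; apply/is_pureP => p.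
by rewrite strand_end_cat Ha -{1}(Hb p) strand_endK.
Qed.

Definition pure_braid : Type := {b : braid | b \in is_pure}.
HB.instance Definition _ := SubChoice.on pure_braid.
HB.instance Definition _ :=
  SubChoice_isSubGroup.Build braid is_pure pure_braid is_pure_group_closed.
End BraidGroup.

(* A braid can be drawn with all strands except the (i+1)-st vertical and straight,
   the (i+1)-st one staying among the i strands to its left and itself, iff it is
   represented by a word all of whose crossings involve that strand (which starts
   at position i) and lie in positions 0, ..., i.  For 0 < i < k this is the free
   group F_i of rank i. *)
Definition in_free (k i : nat) : {pred pure_braid k} :=
  fun b => `[< exists w : braid_word k,
    [/\ val b = braid_class w, only_moves i w & all (fun l => (val l.1 < i)%N) w] >].

Lemma strand_end_out k (w : braid_word k) p : (k <= p)%N -> strand_end w p = p.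
Proof.
move=> kp; elim: w => //= l w IH; rewrite /strand_end /= -/(strand_end w _).
have := ltn_ord l.1; rewrite {1}/cross => lk.
by rewrite !ifF ?IH //; apply/eqP; lia.
Qed.

Lemma strand_end_pure k (b : pure_braid k) w :
  val b = braid_class w -> strand_end w =1 id.
Proof.
move=> bw p; have [kp|pk] := leqP k p; first exact: strand_end_out.
by have := valP b; rewrite bw => /is_pureP /(_ (Ordinal pk)).
Qed.

Fact in_free_group_closed k i : group_closed (@in_free k i).
Proof.
split=> [|a b]; first by apply/asboolP; exists [::].
move=> /asboolP[u [au mu lu]] /asboolP[v [bv mv lv]].
apply/asboolP; exists (u ++ word_inv v); split.
- change (val (a / b)%g) with (braid_mul (val a) (braid_inv (val b))).
  by rewrite au bv braid_invE braid_mulE.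
- rewrite only_moves_cat mu (strand_end_pure au) /=.
  by rewrite -{1}(strand_end_pure bv i); exact: only_moves_inv.
- by rewrite all_cat lu all_rev all_map.
Qed.

Definition free_part (k i : nat) : Type := {b : pure_braid k | b \in @in_free k i}.
HB.instance Definition _ k i := SubChoice.on (free_part k i).
HB.instance Definition _ k i := SubChoice_isSubGroup.Build
  (pure_braid k) (@in_free k i) (free_part k i) (in_free_group_closed k i).

Definition unit_mul (_ _ : unit) := tt.
Fact unit_mulA : associative unit_mul. Proof. by []. Qed.
Fact unit_mul1 : left_id tt unit_mul. Proof. by case. Qed.
Fact unit_mulr1 : right_id tt unit_mul. Proof. by case. Qed.
Fact unit_mulV : left_inverse tt id unit_mul. Proof. by []. Qed.
Fact unit_mulVr : right_inverse tt id unit_mul. Proof. by []. Qed.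
HB.instance Definition _ := isGroup.Build unit
  unit_mulA unit_mul1 unit_mulr1 unit_mulV unit_mulVr.

(* [free_prod k m] is F_m x ... x F_1, with componentwise multiplication. *)
Fixpoint free_prod (k m : nat) : groupType :=
  if m is m'.+1 then (free_part k m * free_prod k m')%type : groupType
  else unit : groupType.

Fixpoint comb_prod (k m : nat) : free_prod k m -> pure_braid k :=
  if m is m'.+1 then
    fun x : free_prod k m'.+1 => (val x.1 * @comb_prod k m' x.2)%g
  else fun=> 1%g.

Definition Pi (k : nat) : groupType := free_prod k k.-1.

(* [combing b] is the tuple of factors of [b]; it is unique by Artin's combing
   theorem, and the default value [1] is never used. *)
Definition combing (k : nat) (b : pure_braid k) : Pi k :=
  xget 1%g [set x : Pi k | comb_prod x = b].

(* Main.v *)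
Require Import Defs.
From HB Require Import structures.
From mathcomp Require Import all_boot all_algebra finmap zify.
From mathcomp Require Import boolp classical_sets functions.
From mathcomp.multinomials Require Import xfinmap monalg.

Set Implicit Arguments.
Unset Strict Implicit.
Unset Printing Implicit Defensive.

Import GRing.Theory BigEnoughFSet.

Local Open Scope classical_set_scope.
Local Open Scope ring_scope.

(** Write [F_m] for the free factor of the strand [m], [P_m] for the group of
    pure braids on the first [m.+1] strands, so that [P_m] is the semidirect
    product of the normal subgroup [F_m] and [P_m.-1], and [E] for combing. The
    theorem holds because the semidirect product is almost direct: [P_m.-1] acts
    trivially on the abelianisation of [F_m].

    For an almost direct product the [n]-th power of the augmentation ideal is
    the sum over [i + j = n] of the products of the [i]-th power for [F_m] and
    the [j]-th power for [P_m.-1]. That sum absorbs [s - 1] on the left for [s]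
    in [P_m.-1] since [(s - 1) * x = (s * x * s^-1 - x) * s + x * (s - 1)], and
    [s * x * s^-1 - x] is one step deeper than [x]: trivial action on the
    abelianisation means trivial action on the first graded piece of the
    augmentation filtration, which generates the other ones
    ([conj_filtration], [filtered_mul_step]). The same description holds for the
    direct product of [F_m] with any group ([aug_pow_prod]), and the inverse of
    [E] carries one sum to the other because it sends [(f, x)] to the product of
    [f] and of the image of [x] ([linear_extension_prod_aug_pow]). Induction on
    [m] then shows that the inverse of [E] carries the powers for the direct
    product of the [F_i] onto those for the pure braid group ([comb_imageE]).

    On the braid side, [F_m] is generated by the loops of the strand [m] around
    the other strands ([moves_ind]), and conjugation by an Artin generator on the
    first [m] strands permutes these loops up to conjugation inside [F_m]
    ([conj_crossing_loop]). Conjugation by a braid therefore permutes their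
    classes in the abelianisation as the braid permutes the strands, and a pure
    braid fixes them ([conj_loop], [conj_pure]).

    That combing exists follows by enumerating the cosets of the braids on the
    first [m] strands, times [F_m], in the braids on [m.+1] strands
    ([below_cosets]); that it is unique follows by forgetting a strand, which
    kills [F_m] and fixes [P_m.-1] ([comb_factor_inj]). *)

(** * Powers of an ideal *)

Section IdealPower.
Variables (A : pzRingType) (I : set A).
Hypothesis IMl : forall a x, I x -> I (a * x).
Hypothesis IMr : forall a x, I x -> I (x * a).

Lemma ideal_mulM (X Y : set A) x y : X x -> Y y -> ideal_mul X Y (x * y).
Proof.
move=> Xx Yy; exists [:: (x, y)]; rewrite big_seq1; split=> // p.
by rewrite inE => /eqP ->.
Qed.

Lemma ideal_mul_ind (X Y P : set A) : P 0 ->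
  (forall x y, P x -> P y -> P (x + y)) ->
  (forall x y, X x -> Y y -> P (x * y)) -> ideal_mul X Y `<=` P.
Proof.
move=> P0 PD PM _ [s [XY ->]]; elim: s XY => [|p s IH] XY; first by rewrite big_nil.
rewrite big_cons; apply: PD.
  by have [] := XY p; rewrite ?mem_head //; exact: PM.
by apply: IH => q qs; apply: XY; rewrite inE qs orbT.
Qed.

Lemma ideal_exp0 n : ideal_exp I n 0.
Proof.
by case: n => [|n] //; exists [::]; rewrite big_nil.
Qed.

Lemma ideal_expD n x y :
  ideal_exp I n x -> ideal_exp I n y -> ideal_exp I n (x + y).
Proof.
case: n => [|n] // [s [Xs ->]] [t [Xt ->]]; exists (s ++ t).
rewrite big_cat; split=> // p; rewrite mem_cat => /orP[]; [exact: Xs|exact: Xt].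
Qed.

Lemma ideal_expMl n a x : ideal_exp I n x -> ideal_exp I n (a * x).
Proof.
case: n => [|n] //; move: x.
apply: (@ideal_mul_ind _ _ [set x | ideal_exp I n.+1 (a * x)]) => /=.
- by rewrite mulr0; exact: (@ideal_exp0 n.+1).
- by move=> x y Hx Hy; rewrite mulrDr; exact: (@ideal_expD n.+1).
- by move=> x y Hx Hy; rewrite mulrA; apply: ideal_mulM => //; exact: IMl.
Qed.

Lemma ideal_expMr n a x : ideal_exp I n x -> ideal_exp I n (x * a).
Proof.
elim: n x => [|n IH] //.
apply: (@ideal_mul_ind _ _ [set x | ideal_exp I n.+1 (x * a)]) => /=.
- by rewrite mul0r; exact: (@ideal_exp0 n.+1).
- by move=> x y Hx Hy; rewrite mulrDl; exact: (@ideal_expD n.+1).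
- by move=> x y Hx Hy; rewrite -mulrA; apply: ideal_mulM => //; exact: IH.
Qed.

Lemma ideal_expM m n x y :
  ideal_exp I m x -> ideal_exp I n y -> ideal_exp I (m + n) (x * y).
Proof.
move=> Hx Hy; elim: m x Hx => [|m IH]; first by move=> x _; exact: ideal_expMl.
apply: (@ideal_mul_ind _ _ [set x | ideal_exp I (m.+1 + n) (x * y)]) => /=.
- by rewrite mul0r; exact: (@ideal_exp0 (m + n).+1).
- by move=> x x' ? ?; rewrite mulrDl; exact: (@ideal_expD (m + n).+1).
- by move=> a b ? ?; rewrite -mulrA; apply: ideal_mulM => //; exact: IH.
Qed.

Lemma ideal_expS n : ideal_exp I n.+1 `<=` ideal_exp I n.
Proof.
apply: ideal_mul_ind; [exact: ideal_exp0|exact: ideal_expD|].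
by move=> x y _; exact: ideal_expMl.
Qed.

Lemma ideal_exp1 x : I x -> ideal_exp I 1 x.
Proof. by move=> Ix; rewrite -(mulr1 x); exact: ideal_mulM. Qed.

End IdealPower.

(** * Group rings *)

Section GroupRingElements.
Variables (R : pzRingType) (G : groupType).
Local Notation RG := (group_ring R G).

Definition gr_elt (g : G) : RG := << 1 *g g >>.
Definition gr_const (c : R) : RG := << c *g 1%g >>.

Lemma gr_eltM g h : gr_elt (g * h)%g = gr_elt g * gr_elt h.
Proof. by rewrite [RHS]gr_mulUU mulr1. Qed.

Lemma gr_elt1 : gr_elt 1%g = 1. Proof. by []. Qed.

Lemma gr_const_elt c g : gr_const c * gr_elt g = << c *g g >>.
Proof. by rewrite [LHS]gr_mulUU mulr1 mul1g. Qed.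

Lemma gr_elt_const c g : gr_elt g * gr_const c = gr_const c * gr_elt g.
Proof. by rewrite gr_const_elt [LHS]gr_mulUU mul1r mulg1. Qed.

Lemma group_ringE (x : RG) :
  x = \sum_(g <- msupp x) gr_const x@_g * gr_elt g.
Proof.
by rewrite [LHS]monalgE; apply: eq_bigr => g _; rewrite gr_const_elt.
Qed.

Lemma group_ring_ind (P : set RG) : P 0 ->
  (forall x y, P x -> P y -> P (x + y)) ->
  (forall c g, P (gr_const c * gr_elt g)) -> forall x, P x.
Proof. by move=> P0 PD PM x; rewrite (group_ringE x); elim/big_ind: _. Qed.

Lemma augmentation_elt g : augmentation (gr_elt g) = 1.
Proof. exact: augmentationU. Qed.

Lemma augmentation_const_elt c g : augmentation (gr_const c * gr_elt g) = c.
Proof. by rewrite gr_const_elt augmentationU. Qed.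

End GroupRingElements.

Section AugmentationPowers.
Variables (R : pzRingType) (G : groupType).
Local Notation RG := (group_ring R G).
Local Notation J := (augmentation_power R G).

Lemma augmentation_idealMl (a x : RG) :
  augmentation_ideal x -> augmentation_ideal (a * x).
Proof. by rewrite /augmentation_ideal /= rmorphM /= => ->; rewrite mulr0. Qed.

Lemma augmentation_idealMr (a x : RG) :
  augmentation_ideal x -> augmentation_ideal (x * a).
Proof. by rewrite /augmentation_ideal /= rmorphM /= => ->; rewrite mul0r. Qed.

Lemma aug_pow0 n : J n 0. Proof. exact: ideal_exp0. Qed.

Lemma aug_powD n x y : J n x -> J n y -> J n (x + y).
Proof. exact: ideal_expD. Qed.

Lemma aug_powMl n a x : J n x -> J n (a * x).
Proof. by apply: ideal_expMl => *; exact: augmentation_idealMl. Qed.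

Lemma aug_powMr n a x : J n x -> J n (x * a).
Proof. by apply: ideal_expMr => *; exact: augmentation_idealMr. Qed.

Lemma aug_powN n x : J n x -> J n (- x).
Proof. by rewrite -mulN1r; exact: aug_powMl. Qed.

Lemma aug_powM m n x y : J m x -> J n y -> J (m + n) (x * y).
Proof. by apply: ideal_expM => *; exact: augmentation_idealMl. Qed.

Lemma aug_powS n : J n.+1 `<=` J n.
Proof. by apply: ideal_expS => *; exact: augmentation_idealMl. Qed.

Lemma aug_pow_elt1 g : J 1 (gr_elt R g - 1).
Proof.
apply: ideal_exp1; rewrite /augmentation_ideal /= rmorphB rmorph1 /=.
by rewrite augmentation_elt subrr.
Qed.

Lemma aug_powSP n x : J n.+1 x = ideal_mul (J 1) (J n) x.
Proof.
apply/propext; split; last first.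
  move: x; apply: (@ideal_mul_ind _ _ _ (J n.+1)); [exact: aug_pow0|exact: aug_powD|].
  by move=> a b; exact: (@aug_powM 1).
move=> [s [sI ->]]; exists s; split=> // p /sI[I1 I2]; split=> //.
exact: ideal_exp1.
Qed.

(** The augmentation ideal is spanned over the scalars by the elements
    [g - 1], so a filtration that these push one step up contains the powers of
    the augmentation ideal. *)
Lemma aug_pow_sub (M : nat -> set RG) :
  (forall x, M 0%N x) -> (forall n, M n 0) ->
  (forall n x y, M n x -> M n y -> M n (x + y)) ->
  (forall n c x, M n x -> M n (gr_const G c * x)) ->
  (forall n g x, M n x -> M n.+1 ((gr_elt R g - 1) * x)) ->
  forall n, J n `<=` M n.
Proof.
move=> Mall M0 MD Mc Mg; elim=> [|n IH]; first by move=> x _; exact: Mall.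
apply: ideal_mul_ind; [exact: M0|exact: MD|] => a y aug_a /IH My.
have -> : a = \sum_(g <- msupp a) gr_const G a@_g * (gr_elt R g - 1).
  under eq_bigr do rewrite mulrBr mulr1.
  rewrite sumrB -group_ringE [X in _ - X](_ : _ = 0) ?subr0 //.
  rewrite -[RHS](@monalgU0 G R 1%g) -aug_a /augmentation.
  by rewrite [RHS]raddf_sum.
rewrite mulr_suml; elim/big_ind: _; [exact: M0|exact: MD|] => g _.
by rewrite -mulrA; apply/Mc/Mg.
Qed.

End AugmentationPowers.

Section LinearExtension.
Variables (R : pzRingType) (G H : groupType) (f : G -> H).
Local Notation L := (linear_extension R f).

Lemma linear_extensionEw (d : {fset G}) x : (msupp x `<=` d)%fset ->
  L x = \sum_(g <- d) << x@_g *g f g >>.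
Proof.
by move=> le; apply: big_fset_incl => // g _ /mcoeff_outdom ->; rewrite monalgU0.
Qed.

Fact linear_extension_is_zmod_morphism : zmod_morphism L.
Proof.
move=> x y; pose_big_fset G E.
  rewrite 3?(linear_extensionEw (d := E)) //.
  by rewrite -sumrB; apply: eq_bigr => g _; rewrite mcoeffB monalgUB.
by close.
Qed.
HB.instance Definition _ :=
  GRing.isZmodMorphism.Build (group_ring R G) (group_ring R H) L
    linear_extension_is_zmod_morphism.

Lemma linear_extension0 : L 0 = 0. Proof. exact: raddf0. Qed.

Lemma linear_extensionD x y : L (x + y) = L x + L y.
Proof. exact: raddfD. Qed.

Lemma linear_extensionB x y : L (x - y) = L x - L y.
Proof. exact: raddfB. Qed.

Lemma linear_extensionU c g : L (gr_const G c * gr_elt R g) =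
  gr_const H c * gr_elt R (f g).
Proof.
rewrite !gr_const_elt (linear_extensionEw msuppU_le) big_seq_fset1.
by rewrite mcoeffUU.
Qed.

Lemma linear_extension_elt g : L (gr_elt R g) = gr_elt R (f g).
Proof. by have := linear_extensionU 1 g; rewrite !mul1r. Qed.

Lemma linear_extension_const c x :
  L (gr_const G c * x) = gr_const H c * L x.
Proof.
move: x; apply: group_ring_ind => [|x y Hx Hy|d g].
- by rewrite mulr0 linear_extension0 mulr0.
- by rewrite mulrDr !linear_extensionD Hx Hy mulrDr.
- have cM (K : groupType) : gr_const K c * gr_const K d = gr_const K (c * d).
    by rewrite [LHS]gr_mulUU mulg1.
  by rewrite linear_extensionU !mulrA !cM linear_extensionU.
Qed.

Lemma augmentation_linear_extension x : augmentation (L x) = augmentation x.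
Proof.
move: x; apply: group_ring_ind => [|x y Hx Hy|d g]; first by rewrite !raddf0.
  by rewrite linear_extensionD !raddfD /= Hx Hy.
by rewrite linear_extensionU !augmentation_const_elt.
Qed.

Hypothesis fM : {morph f : x y / (x * y)%g}.

Lemma linear_extensionM x y : L (x * y) = L x * L y.
Proof.
move: x; apply: group_ring_ind => [|x x' Hx Hx'|c g].
- by rewrite mul0r linear_extension0 mul0r.
- by rewrite mulrDl !linear_extensionD mulrDl Hx Hx'.
rewrite linear_extensionU -!mulrA linear_extension_const; congr (_ * _).
move: y; apply: group_ring_ind => [|y y' Hy Hy'|d h].
- by rewrite mulr0 linear_extension0 mulr0.
- by rewrite mulrDr !linear_extensionD mulrDr Hy Hy'.
by rewrite mulrA gr_elt_const -mulrA -gr_eltM !linear_extensionU mulrA gr_elt_const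
           -mulrA -gr_eltM fM.
Qed.

Lemma linear_extension_aug_pow n x :
  augmentation_power R G n x -> augmentation_power R H n (L x).
Proof.
elim: n x => [|n IH] //; apply: ideal_mul_ind => /=.
- by rewrite linear_extension0; exact: aug_pow0.
- by move=> x y ? ?; rewrite linear_extensionD; exact: aug_powD.
move=> x y Hx Hy; rewrite linear_extensionM; apply: ideal_mulM; last exact: IH.
by rewrite /augmentation_ideal /= augmentation_linear_extension.
Qed.

End LinearExtension.

Lemma linear_extension_id (R : pzRingType) (G : groupType) (f : G -> G) x :
  f =1 id -> linear_extension R f x = x.
Proof.
move=> f1; move: x; apply: group_ring_ind => [|x y Hx Hy|c g].
- exact: linear_extension0.
- by rewrite linear_extensionD Hx Hy.
- by rewrite linear_extensionU f1.
Qed.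

Lemma linear_extension_comp (R : pzRingType) (G H K : groupType)
    (f : G -> H) (g : H -> K) x :
  linear_extension R g (linear_extension R f x) = linear_extension R (g \o f) x.
Proof.
move: x; apply: group_ring_ind => [|x y Hx Hy|c h].
- by rewrite !linear_extension0.
- by rewrite !linear_extensionD Hx Hy.
- by rewrite !linear_extensionU.
Qed.

(** * Products of two filtrations *)

Section FilteredProduct.
Variables (A : pzRingType) (N D : nat -> set A).

(** The [n]-th term of the product filtration: the additive span of the products
    [x * y] with [x] in [N i], [y] in [D j] and [i + j = n]. *)
Inductive filtered_mul n : set A :=
| FilteredMul0 : filtered_mul n 0
| FilteredMulD i j x y z : (i + j)%N = n -> N i x -> D j y ->
    filtered_mul n z -> filtered_mul n (x * y + z).

Lemma filtered_mulM i j x y : N i x -> D j y -> filtered_mul (i + j) (x * y).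
Proof.
by move=> Nx Dy; rewrite -[x * y]addr0; apply: FilteredMulD Nx Dy _ => //; left.
Qed.

Lemma filtered_mulD n x y :
  filtered_mul n x -> filtered_mul n y -> filtered_mul n (x + y).
Proof.
move=> Mx My; elim: Mx => [|i j a b z ij Na Db _ IH]; first by rewrite add0r.
by rewrite -addrA; apply: FilteredMulD ij Na Db IH.
Qed.

Lemma filtered_mul_additive_ind n (P : set A) : P 0 ->
  (forall x y, P x -> P y -> P (x + y)) ->
  (forall i j x y, (i + j)%N = n -> N i x -> D j y -> P (x * y)) ->
  filtered_mul n `<=` P.
Proof.
move=> P0 PD PM t Mt; elim: Mt => [|i j x y z ij Nx Dy _ IH] //.
by apply: PD => //; apply: PM ij Nx Dy.
Qed.

Hypothesis N0 : forall i, N i 0.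
Hypothesis ND : forall i x y, N i x -> N i y -> N i (x + y).
Hypothesis NM : forall i j x y, N i x -> N j y -> N (i + j) (x * y).
Hypothesis NS : forall i, N i.+1 `<=` N i.
Hypothesis N_gen : forall i, N i.+1 `<=` ideal_mul (N 1%N) (N i).
Hypothesis DD : forall i x y, D i x -> D i y -> D i (x + y).
Hypothesis DS : forall i, D i.+1 `<=` D i.

Lemma filtered_mulS n : filtered_mul n.+1 `<=` filtered_mul n.
Proof.
apply: filtered_mul_additive_ind; [by left|exact: filtered_mulD|] => -[|i] j x y.
  rewrite add0n => -> Nx Dy; rewrite -[n]add0n.
  by apply: filtered_mulM => //; apply: DS.
by rewrite addSn => -[<-] /NS Nx Dy; apply: filtered_mulM.
Qed.

Lemma filtered_mulMl n a z :
  N 1%N a -> filtered_mul n z -> filtered_mul n.+1 (a * z).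
Proof.
move=> Na; move: z.
apply: (@filtered_mul_additive_ind _ [set z | filtered_mul n.+1 (a * z)]) => /=.
- by rewrite mulr0; left.
- by move=> x y Hx Hy; rewrite mulrDr; apply: filtered_mulD.
- move=> i j x y <- Nx Dy; rewrite mulrA -addSn; apply: filtered_mulM => //.
  exact: (@NM 1).
Qed.

Variables u u' : A.
Hypothesis u'u : u' * u = 1.
Hypothesis conj_u : forall x, N 0%N x -> N 2 (u * x * u' - x).
Hypothesis Du : forall j y, D j y -> D j.+1 ((u - 1) * y).

(** Because [N i.+1] is generated by [N 1] and [N i], a conjugation that is
    trivial from [N 0] to the quotient by [N 2] is trivial on every graded
    piece: if it sends [a] to [a'] and [b] to [b'], then it moves [a * b] by
    [(a' - a) * b' + a * (b' - b)], and for [a] in [N 1] and [b] in [N i] the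
    difference [a' - a] is in [N 2] and, by induction, [b' - b] is in [N i.+1]. *)
Lemma conj_filtration i x : N i x -> N i.+1 (u * x * u' - x).
Proof.
elim: i x => [|i IH] x; first by move=> /conj_u /NS.
move=> /N_gen; move: x.
apply: (@ideal_mul_ind _ _ _ [set x | N i.+2 (u * x * u' - x)]) => /=.
- by rewrite mulr0 mul0r subr0.
- move=> x y Hx Hy; rewrite mulrDr mulrDl opprD addrACA; exact: ND.
move=> a b Na Nb.
have -> : u * (a * b) * u' - a * b =
    (u * a * u' - a) * (u * b * u') + a * (u * b * u' - b).
  rewrite mulrBl mulrBr addrA subrK; congr (_ - _).
  by rewrite !mulrA -(mulrA (u * a) u') u'u mulr1.
have Nub : N i (u * b * u').
  by rewrite -[_ * u'](subrK b); apply: ND => //; apply/NS/IH.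
apply: ND; first by apply: (@NM 2 i) => //; apply/conj_u/NS.
by apply: (@NM 1 i.+1) => //; exact: IH.
Qed.

(** Moving [u] across the first factor costs only the commutator term of
    [conj_filtration]:
    [(u - 1) * (x * y) = (u * x * u' - x) * (u * y) + x * ((u - 1) * y)]. *)
Lemma filtered_mul_conj n z :
  filtered_mul n z -> filtered_mul n.+1 ((u - 1) * z).
Proof.
move: z; apply: (@filtered_mul_additive_ind _ [set z | filtered_mul n.+1 ((u - 1) * z)]) => /=.
- by rewrite mulr0; left.
- by move=> x y Hx Hy; rewrite mulrDr; apply: filtered_mulD.
move=> i j x y <- Nx Dy.
have -> : (u - 1) * (x * y) = (u * x * u' - x) * (u * y) + x * ((u - 1) * y).
  rewrite !mulrBl !mulrBr !mul1r addrA !mulrA.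
  by rewrite -(mulrA (u * x) u') u'u mulr1 subrK.
have Duy : D j (u * y).
  by rewrite -[u * y](subrK y) -{2}[y]mul1r -mulrBl; apply: DD => //; apply/DS/Du.
apply: filtered_mulD; first by rewrite -addSn; apply: filtered_mulM => //; apply: conj_filtration.
by rewrite -addnS; apply: filtered_mulM => //; exact: Du.
Qed.

End FilteredProduct.

Section AlmostDirectProduct.
Variables (R : pzRingType) (H G : groupType) (f : H -> G).
Hypothesis fM : {morph f : x y / (x * y)%g}.
Variable D : nat -> set (group_ring R G).
Hypothesis DD : forall i x y, D i x -> D i y -> D i (x + y).
Hypothesis DS : forall i, D i.+1 `<=` D i.

Let N i := linear_extension R f @` augmentation_power R H i.

Let N0 i : N i 0.
Proof. by exists 0; [exact: aug_pow0|rewrite linear_extension0]. Qed.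

Let ND i x y : N i x -> N i y -> N i (x + y).
Proof.
move=> [a Ja <-] [b Jb <-]; exists (a + b); last by rewrite linear_extensionD.
exact: aug_powD.
Qed.

Let NM i j x y : N i x -> N j y -> N (i + j) (x * y).
Proof.
move=> [a Ja <-] [b Jb <-]; exists (a * b); last exact: linear_extensionM.
exact: aug_powM.
Qed.

Let Nconst i c x : N i x -> N i (gr_const G c * x).
Proof.
move=> [a Ja <-]; exists (gr_const H c * a); first exact: aug_powMl.
exact: linear_extension_const.
Qed.

Let NS i : N i.+1 `<=` N i.
Proof. by move=> _ [a Ja <-]; exists a => //; exact: aug_powS. Qed.

Let N_gen i : N i.+1 `<=` ideal_mul (N 1%N) (N i).
Proof.
move=> _ [a Ja <-]; move: a Ja => /= a; rewrite aug_powSP; move: a.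
apply: (@ideal_mul_ind _ _ _
  [set a | ideal_mul (N 1%N) (N i) (linear_extension R f a)]) => /=.
- by rewrite linear_extension0; exists [::]; rewrite big_nil.
- move=> x y [s [Hs Es]] [t [Ht Et]]; exists (s ++ t).
  rewrite linear_extensionD Es Et big_cat; split=> // p.
  by rewrite mem_cat => /orP[/Hs|/Ht].
- by move=> x y Jx Jy; rewrite linear_extensionM //; apply: ideal_mulM; [exists x|exists y].
Qed.

(** Conjugation by [s] preserves the image of [H] and acts trivially on its
    abelianisation, expressed in the group ring: since [N 2] is the image of the
    square of the augmentation ideal, both facts are one condition. *)
Definition trivial_mod_square (s : G) := forall h,
  N 2 (gr_elt R (s * f h * s^-1)%g - gr_elt R (f h)).

Lemma trivial_mod_square_conj s : trivial_mod_square s ->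
  forall x, N 0%N x -> N 2 (gr_elt R s * x * gr_elt R s^-1%g - x).
Proof.
move=> sH _ [a _ <-]; move: a; apply: group_ring_ind => [|x y Hx Hy|c h].
- by rewrite linear_extension0 mulr0 mul0r subr0.
- by rewrite linear_extensionD mulrDr mulrDl opprD addrACA; exact: ND.
rewrite linear_extensionU mulrA gr_elt_const -!mulrA -mulrBr -!gr_eltM mulgA.
exact: Nconst.
Qed.

Lemma filtered_mul_const n c x :
  filtered_mul N D n x -> filtered_mul N D n (gr_const G c * x).
Proof.
move: x; apply: (@filtered_mul_additive_ind _ _ _ _
  [set x | filtered_mul N D n (gr_const G c * x)]) => /=.
- by rewrite mulr0; left.
- by move=> x y Hx Hy; rewrite mulrDr; apply: filtered_mulD.
- by move=> i j x y <- Nx Dy; rewrite mulrA; apply: filtered_mulM => //; apply: Nconst.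
Qed.

(** As [f h * s - 1 = (f h - 1) * s + (s - 1)], both factors of an almost direct
    product push the product filtration one step up. *)
Lemma filtered_mul_step n h s z : trivial_mod_square s ->
  (forall j y, D j y -> D j.+1 ((gr_elt R s - 1) * y)) ->
  filtered_mul N D n z ->
  filtered_mul N D n.+1 ((gr_elt R (f h * s)%g - 1) * z).
Proof.
move=> sH sD Mz.
have Ms : filtered_mul N D n.+1 ((gr_elt R s - 1) * z).
  have s's : gr_elt R s^-1%g * gr_elt R s = 1 by rewrite -gr_eltM mulVg.
  exact: (filtered_mul_conj N0 ND NM NS N_gen DD DS s's (trivial_mod_square_conj sH)).
have -> : (gr_elt R (f h * s)%g - 1) * z =
    (gr_elt R (f h) - 1) * (gr_elt R s * z) + (gr_elt R s - 1) * z.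
  by rewrite mulrA -mulrDl; congr (_ * _); rewrite mulrBl mul1r gr_eltM addrA subrK.
apply: (filtered_mulD _ Ms); apply: (filtered_mulMl NM).
  have f1 : f 1%g = 1%g by apply: (@mulgI _ (f 1%g)); rewrite -fM !mulg1.
  exists (gr_elt R h - 1); first exact: aug_pow_elt1.
  by rewrite linear_extensionB -gr_elt1 !linear_extension_elt f1.
rewrite -[_ * z](subrK z) -{2}[z]mul1r -mulrBl; apply: filtered_mulD => //.
exact: (filtered_mulS NS DS).
Qed.

End AlmostDirectProduct.

Section DirectProduct.
Variables (R : pzRingType) (H K : groupType).
Local Notation HK := (H * K)%type.
Let inl (h : H) : HK := (h, 1%g).
Let inr (k : K) : HK := (1%g, k).

Let inlM : {morph inl : x y / (x * y)%g}.
Proof. by move=> x y; congr pair; rewrite /= mulg1. Qed.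
Let inrM : {morph inr : x y / (x * y)%g}.
Proof. by move=> x y; congr pair; rewrite /= mulg1. Qed.

(** In a direct product the two factors commute, so the conjugation condition of
    [filtered_mul_step] holds with a vanishing difference. *)
Lemma aug_pow_prod n : augmentation_power R HK n =
  filtered_mul (fun i => linear_extension R inl @` augmentation_power R H i)
               (fun j => linear_extension R inr @` augmentation_power R K j) n.
Proof.
have DD i x y : (linear_extension R inr @` augmentation_power R K i) x ->
    (linear_extension R inr @` augmentation_power R K i) y ->
    (linear_extension R inr @` augmentation_power R K i) (x + y).
  move=> [a Ja <-] [b Jb <-]; exists (a + b); last by rewrite linear_extensionD.
  exact: aug_powD.
apply/seteqP; split; last first.
  apply: filtered_mul_additive_ind; [exact: aug_pow0|exact: aug_powD|].
  move=> i j _ _ <- [a Ja <-] [b Jb <-].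
  by apply: aug_powM; exact: linear_extension_aug_pow.
apply: (@aug_pow_sub _ _ (filtered_mul _ _)).
- apply: group_ring_ind; [by left|exact: filtered_mulD|] => c [h k].
  have -> : gr_elt R (h, k) = gr_elt R (inl h) * gr_elt R (inr k).
    by rewrite -gr_eltM; congr gr_elt; congr pair; rewrite ?mulg1 ?mul1g.
  rewrite mulrA -linear_extensionU -linear_extension_elt.
  apply: (@filtered_mulM _ _ _ 0 0); first by exists (gr_const H c * gr_elt R h).
  by exists (gr_elt R k).
- by left.
- by move=> m x y; exact: filtered_mulD.
- by move=> m c x; exact: filtered_mul_const.
move=> m [h k] x Mx.
have -> : (h, k) = (inl h * inr k)%g by congr pair; rewrite ?mulg1 ?mul1g.
apply: filtered_mul_step => //.
- by move=> i _ [a Ja <-]; exists a => //; exact: aug_powS.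
- move=> h'; rewrite (_ : (_ * _^-1)%g = inl h'); last first.
    by congr pair; rewrite /= ?invg1 ?mulg1 ?mul1g ?mulgV.
  by rewrite subrr; exists 0; [exact: aug_pow0|rewrite linear_extension0].
move=> j _ [a Ja <-]; exists ((gr_elt R k - 1) * a).
  by apply: (@aug_powM _ _ 1) => //; exact: aug_pow_elt1.
rewrite (linear_extensionM inrM) (linear_extensionB inr) -gr_elt1.
by rewrite !linear_extension_elt.
Qed.

(** In the application [f] embeds a free factor in the pure braid group and [g]
    multiplies out the remaining factors, which is not a morphism. *)
Variables (G : groupType) (f : H -> G) (g : K -> G).
Hypothesis fM : {morph f : x y / (x * y)%g}.
Let mu (x : HK) : G := (f x.1 * g x.2)%g.

(** Although [mu] is not a morphism, it is multiplicative on the products of an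
    element of [H] by one of [K], in this order. *)
Lemma linear_extension_prod a b :
  linear_extension R mu (linear_extension R inl a * linear_extension R inr b) =
  linear_extension R f a * linear_extension R g b.
Proof.
move: a; apply: group_ring_ind => [|x y Hx Hy|c h].
- by rewrite !linear_extension0 !mul0r linear_extension0.
- rewrite (linear_extensionD inl x) (linear_extensionD f x).
  rewrite [RHS]mulrDl -Hx -Hy mulrDl.
  exact: linear_extensionD.
rewrite !linear_extensionU -!mulrA linear_extension_const; congr (_ * _).
move: b; apply: group_ring_ind => [|y y' Hy Hy'|d k].
- by rewrite !linear_extension0 !mulr0 linear_extension0.
- rewrite (linear_extensionD inr y) (linear_extensionD g y).
  rewrite [RHS]mulrDr -Hy -Hy' mulrDr.
  exact: linear_extensionD.
rewrite !linear_extensionU !mulrA !gr_elt_const -!mulrA -!gr_eltM.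
by rewrite linear_extensionU /mu /= mulg1 mul1g.
Qed.

Lemma linear_extension_prod_aug_pow n :
  linear_extension R mu @` augmentation_power R HK n =
  filtered_mul (fun i => linear_extension R f @` augmentation_power R H i)
               (fun j => linear_extension R g @` augmentation_power R K j) n.
Proof.
rewrite aug_pow_prod; apply/seteqP; split.
  move=> _ [z Mz <-]; elim: Mz => [|i j x y z' ij [a Ja <-] [b Jb <-] _ IH].
    by rewrite linear_extension0; left.
  rewrite linear_extensionD linear_extension_prod; apply: FilteredMulD ij _ _ IH.
    by exists a.
  by exists b.
apply: filtered_mul_additive_ind.
- by exists 0; [left|rewrite linear_extension0].
- move=> _ _ [x Mx <-] [y My <-]; exists (x + y); last by rewrite linear_extensionD.
  exact: filtered_mulD.
move=> i j _ _ ij [a Ja <-] [b Jb <-].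
exists (linear_extension R inl a * linear_extension R inr b).
  by rewrite -ij; apply: filtered_mulM; [exists a|exists b].
exact: linear_extension_prod.
Qed.

Lemma almost_direct_product_step n h k z :
  (forall j y, (linear_extension R g @` augmentation_power R K j) y ->
     (linear_extension R g @` augmentation_power R K j.+1)
       ((gr_elt R (g k) - 1) * y)) ->
  trivial_mod_square R f (g k) ->
  (linear_extension R mu @` augmentation_power R HK n) z ->
  (linear_extension R mu @` augmentation_power R HK n.+1)
    ((gr_elt R (mu (h, k)) - 1) * z).
Proof.
rewrite !linear_extension_prod_aug_pow => gD kH; apply: filtered_mul_step => //.
- move=> i x y [a Ja <-] [b Jb <-]; exists (a + b); last by rewrite linear_extensionD.
  exact: aug_powD.
- by move=> i _ [a Ja <-]; exists a => //; exact: aug_powS.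
Qed.

End DirectProduct.

(** * Artin generators *)

Section ArtinGenerators.
Variable k : nat.
Local Open Scope nat_scope.
Local Notation B := (braid k).
Implicit Types (a b : B) (w u v : braid_word k) (i j p q m : nat).

(** Indexing by all of [nat], with the value [1] out of range, keeps ordinals out
    of the products below. *)
Definition sigma i : B :=
  if insub i is Some j then braid_class [:: (j, true)] else 1%g.

Definition crossing i (c : bool) : B := if c then sigma i else (sigma i)^-1%g.

Lemma braid_class_cat u v : braid_class (u ++ v) = (braid_class u * braid_class v)%g.
Proof. by rewrite [RHS]braid_mulE. Qed.

Lemma sigma_ord (j : 'I_k.-1) : sigma j = braid_class [:: (j, true)].
Proof. by rewrite /sigma valK. Qed.

Lemma braid_class1 l : braid_class [:: l] = crossing l.1 l.2.
Proof.
case: l => i [] ; rewrite /crossing /= sigma_ord //.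
by rewrite [RHS]braid_invE.
Qed.

Lemma braid_class_cons l w : braid_class (l :: w) = (crossing l.1 l.2 * braid_class w)%g.
Proof. by rewrite -cat1s braid_class_cat braid_class1. Qed.

Lemma sigma_far i j : i.+1 < j -> commute (sigma i) (sigma j).
Proof.
move=> ij; rewrite /commute /sigma; case: insubP => [i' _ ii|_]; last by rewrite mul1g mulg1.
case: insubP => [j' _ jj|_]; last by rewrite mul1g mulg1.
rewrite -!braid_class_cat; apply/braid_classP/BraidFar; rewrite /= in ii jj.
by rewrite ii jj.
Qed.

Lemma sigma_artin i : i.+1 < k.-1 ->
  (sigma i * sigma i.+1 * sigma i = sigma i.+1 * sigma i * sigma i.+1)%g.
Proof.
move=> lt; rewrite -[i in sigma i]/(val (Ordinal (ltnW lt))).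
rewrite -[i.+1]/(val (Ordinal lt)) !sigma_ord -!braid_class_cat.
exact/braid_classP/BraidArtin.
Qed.

Definition braid_end b p := strand_end (repr b) p.

Lemma braid_end_class w p : braid_end (braid_class w) p = strand_end w p.
Proof. exact: strand_end_equiv (repr_braid_class w) p. Qed.

Lemma braid_endM a b p : braid_end (a * b)%g p = braid_end b (braid_end a p).
Proof.
rewrite -(braid_classK a) -(braid_classK b) -braid_class_cat !braid_end_class.
exact: strand_end_cat.
Qed.

Lemma braid_end1 p : braid_end 1%g p = p.
Proof. exact: (braid_end_class [::]). Qed.

Lemma braid_endK b : cancel (braid_end b) (braid_end b^-1%g).
Proof. by move=> p; rewrite -braid_endM mulgV braid_end1. Qed.

Lemma braid_end_sigma i p : i < k.-1 -> braid_end (sigma i) p = cross i p.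
Proof.
by move=> lt; rewrite -[i]/(val (Ordinal lt)) sigma_ord braid_end_class.
Qed.

Lemma braid_end_crossing i c p : i < k.-1 -> braid_end (crossing i c) p = cross i p.
Proof.
move=> lt; case: c; first exact: braid_end_sigma.
by rewrite -{1}(crossK i p) -braid_end_sigma // braid_endK.
Qed.

Lemma cross_le i p m : i < m -> (cross i p <= m) = (p <= m).
Proof. by rewrite /cross; case: (p =P i) => [->|_]; last case: (p =P i.+1) => [->|//]; lia. Qed.

(** The braids supported on the first [m.+1] strands, as these are the strands
    that crossings at positions less than [m] involve. *)
Definition below m b := exists2 w, b = braid_class w & all (fun l => val l.1 < m) w.

Lemma below_ind m (P : B -> Prop) : P 1%g ->
  (forall b i c, i < m -> i < k.-1 -> below m b -> P b -> P (b * crossing i c)%g) ->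
  forall b, below m b -> P b.
Proof.
move=> P1 Pc b [w -> {b}]; elim/last_ind: w => [|w [i c] IH] //.
rewrite all_rcons /= -cats1 braid_class_cat braid_class1 => /andP[im wm].
by apply: Pc => //; [exists w|exact: IH].
Qed.

Lemma below1 m : below m 1%g. Proof. by exists [::]. Qed.

Lemma belowM m a b : below m a -> below m b -> below m (a * b)%g.
Proof.
move=> [u -> um] [v -> vm]; exists (u ++ v); first by rewrite braid_class_cat.
by rewrite all_cat um.
Qed.

Lemma belowV m b : below m b -> below m b^-1%g.
Proof.
move=> [w -> wm]; exists (word_inv w); first exact: braid_invE.
by rewrite all_rev all_map.
Qed.

Lemma below_sigma m i : i < m -> below m (sigma i).
Proof.
rewrite /sigma; case: insubP => [j _ <- jm|_ _]; last exact: below1.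
by exists [:: (j, true)]; rewrite //= jm.
Qed.

Lemma below_le m n b : m <= n -> below m b -> below n b.
Proof.
move=> mn [w -> wm]; exists w => //; apply: sub_all wm => l lm.
exact: leq_trans mn.
Qed.

Lemma below_end_le m b p : below m b -> (braid_end b p <= m) = (p <= m).
Proof.
move=> Hb; move: b Hb p; apply: below_ind => [p|b i c im ik _ IH p].
  by rewrite braid_end1.
by rewrite braid_endM braid_end_crossing // cross_le.
Qed.

Lemma below_end_gt m b p : below m b -> m < p -> braid_end b p = p.
Proof.
move=> Hb mp; move: b Hb; apply: below_ind => [|b i c im ik _ IH].
  by rewrite braid_end1.
rewrite braid_endM braid_end_crossing // IH /cross.
by case: (p =P i) => [|_]; last case: (p =P i.+1) => //; lia.
Qed.

(** * The free group of a moving strand *)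

(** For a pure braid, [moves m m m] is membership in [F_m]. Keeping the end
    positions [p] and [q] apart makes these braids a groupoid, in which an
    element of [F_m] can be cut into its letters. *)
Definition moves m p q b := exists w,
  [/\ b = braid_class w, only_moves p w, all (fun l => val l.1 < m) w
    & strand_end w p = q].

Lemma moves1 m p : moves m p p 1%g. Proof. by exists [::]. Qed.

Lemma movesM m p q r a b : moves m p q a -> moves m q r b -> moves m p r (a * b)%g.
Proof.
move=> [u [-> pu um uq]] [v [-> qv vm vr]]; exists (u ++ v).
by rewrite braid_class_cat only_moves_cat pu uq qv all_cat um vm strand_end_cat uq.
Qed.

Lemma movesV m p q b : moves m p q b -> moves m q p b^-1%g.
Proof.
move=> [w [-> pw wm <-]]; exists (word_inv w); split.
- exact: braid_invE.
- exact: only_moves_inv.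
- by rewrite all_rev all_map.
- exact: strand_endK.
Qed.

Lemma moves_sigma m i : i < m -> i < k.-1 -> moves m i i.+1 (sigma i).
Proof.
move=> im lt; exists [:: (Ordinal lt, true)].
by rewrite -sigma_ord /= im eqxx /strand_end /cross /= eqxx.
Qed.

Lemma moves_sigma_rev m i : i < m -> i < k.-1 -> moves m i.+1 i (sigma i).
Proof.
move=> im lt; exists [:: (Ordinal lt, true)].
by rewrite -sigma_ord /= im eqxx orbT /strand_end /cross /= eqxx gtn_eqF.
Qed.

(** The product [sigma m.-1 * ... * sigma p], which carries the strand at position
    [m] to position [p]: the base path of the groupoid [moves m], and a coset
    representative in the combing process. *)
Definition descend m p : B := (\prod_(i <- rev (iota p (m - p))) sigma i)%g.

Lemma descend_id m : descend m m = 1%g.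
Proof. by rewrite /descend subnn big_nil. Qed.

Lemma descendS m p : p < m -> descend m p = (descend m p.+1 * sigma p)%g.
Proof.
by move=> pm; rewrite /descend -(subnSK pm) /= rev_cons -cats1 big_cat big_seq1.
Qed.

Lemma down_ind m (P : nat -> Prop) :
  P m -> (forall p, p < m -> P p.+1 -> P p) -> forall p, p <= m -> P p.
Proof.
move=> Pm PS p pm; rewrite -(subKn pm).
elim: (m - p) (leq_subr p m) => [|d IH] dm; first by rewrite subn0.
by apply: PS; [lia|rewrite subnSK //; apply: IH; exact: ltnW].
Qed.

Lemma descend_moves m p : m <= k.-1 -> p <= m -> moves m m p (descend m p).
Proof.
move=> mk; move: p; apply: down_ind => [|p pm IH].
  by rewrite descend_id; exact: moves1.
rewrite descendS //; apply: movesM IH _; apply: moves_sigma_rev => //.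
Qed.

Lemma descend_far m p i : p <= m -> i.+1 < p -> commute (sigma i) (descend m p).
Proof.
move: p; apply: down_ind => [_|p pm IH ip]; first by rewrite descend_id; exact: commute1.
rewrite descendS //; apply: commuteM; first by apply: IH; exact: ltnW.
exact: sigma_far.
Qed.

(** A crossing to the right of [p] slides along the moving strand, and shifts
    its position by one: this is the braid relation, once the moving
    strand has commuted past the generators far from the crossing. *)
Lemma descend_shift m p i : m <= k.-1 -> p <= i -> i.+1 < m ->
  (sigma i * descend m p = descend m p * sigma i.+1)%g.
Proof.
move=> mk pi im; move: p pi; apply: down_ind => [|p pi IH].
  rewrite (descendS (ltnW im)) (descendS im) !mulgA.
  rewrite (descend_far im) // -!mulgA; congr (_ * _)%g.
  by rewrite !mulgA sigma_artin //; exact: leq_trans mk.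
rewrite descendS; last by lia.
by rewrite mulgA IH -!mulgA; congr (_ * _)%g; rewrite -sigma_far.
Qed.

(** The strand [m] goes to the right of the strand [j], makes a full turn around
    it, and comes back along the same path. *)
Definition loop m j : B :=
  (descend m j.+1 * (sigma j * sigma j) * (descend m j.+1)^-1)%g.

Lemma loop_moves m j : m <= k.-1 -> j < m -> moves m m m (loop m j).
Proof.
move=> mk jm; have jk := leq_trans jm mk.
apply: movesM (movesV (descend_moves mk jm)).
apply: movesM (descend_moves mk jm) _.
exact: movesM (moves_sigma_rev jm jk) (moves_sigma jm jk).
Qed.

Lemma loop_end m j p : m <= k.-1 -> j < m -> braid_end (loop m j) p = p.
Proof.
move=> mk jm; have jk := leq_trans jm mk.
by rewrite !braid_endM !braid_end_sigma // crossK braid_endK.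
Qed.

(** The loops generate [F_m]: inserting [(descend m q)^-1 * descend m q] after
    each letter [l] of a word in which only one strand moves cuts it into pieces
    [descend m p * l * (descend m q)^-1], where [l] takes the strand from [p] to
    [q], and each piece is [1], a loop or the inverse of a loop. *)
Lemma moves_ind m (P : B -> Prop) : m <= k.-1 -> P 1%g ->
  (forall a b, P a -> P b -> P (a * b)%g) -> (forall a, P a -> P a^-1%g) ->
  (forall j, j < m -> P (loop m j)) -> forall b, moves m m m b -> P b.
Proof.
move=> mk P1 PM PV PL.
suff H w p q : p <= m -> only_moves p w -> all (fun l => val l.1 < m) w ->
    strand_end w p = q -> P (descend m p * braid_class w * (descend m q)^-1)%g.
  move=> b [w [-> mw wm wend]]; have := H w m m (leqnn m) mw wm wend.
  by rewrite descend_id mul1g invg1 mulg1.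
elim: w p => [|[i c] w IH] p pm /=.
  by move=> _ _ <-; rewrite [braid_class _](_ : _ = 1%g) // mulg1 mulgV.
move=> /andP[pi mw] /andP[im wm] wq.
have im' : cross i p <= m by rewrite cross_le.
have {IH mw wm wq} := IH _ im' mw wm wq; set b := braid_class w; move=> Pb.
rewrite braid_class_cons -/b.
have -> : (descend m p * (crossing i c * b) * (descend m q)^-1 =
   (descend m p * crossing i c * (descend m (cross i p))^-1) *
   (descend m (cross i p) * b * (descend m q)^-1))%g.
  by rewrite !mulgA mulgVK.
apply: PM => //; rewrite /crossing /=.
case/orP: pi => /eqP ->; rewrite /cross ?eqxx ?gtn_eqF // (descendS im).
  case: c; first by rewrite -(mulgA _ _ (sigma i)); exact: PL.
  by rewrite mulgK mulgV.
case: c; first by rewrite mulgV.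
rewrite (_ : (_ * _^-1 * _)%g = (loop m i)^-1%g); first exact/PV/PL.
by rewrite /loop !invgM invgK !mulgA.
Qed.

Lemma commute_shift (x y t z : B) : (x * t = t * y)%g -> commute y z ->
  commute x (t * z * t^-1)%g.
Proof.
move=> xt yz; rewrite /commute !mulgA xt -(mulgA t) yz !mulgA.
have tx : (y * t^-1 = t^-1 * x)%g by rewrite -[x in RHS](mulgK t) xt !mulgA mulVg mul1g.
by rewrite -!mulgA tx.
Qed.

Lemma sigma_loop_low m i j : m <= k.-1 -> i.+1 < m -> j < i ->
  commute (sigma i) (loop m j).
Proof.
move=> mk im ji; apply: (commute_shift (descend_shift mk ji im)).
by apply: commuteM; apply: commute_sym; exact: sigma_far.
Qed.

Lemma sigma_loop_high m i j : i.+1 < j -> j < m ->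
  commute (sigma i) (loop m j).
Proof.
move=> ij jm; apply: (@commute_shift _ (sigma i)).
  by apply: descend_far => //; exact: ltnW.
by apply: commuteM; exact: sigma_far.
Qed.

(** All computations with adjacent loops take place in the subgroup generated by
    [a = sigma i] and [b = sigma i.+1], because both loops are conjugated by the
    same path [T], which commutes with [a]: they become [b * a^2 * b^-1] and
    [b^2]. *)
Section AdjacentLoops.
Variables m i : nat.
Hypothesis mk : m <= k.-1.
Hypothesis im : i.+1 < m.
Let T := descend m i.+2.
Let a := sigma i.
Let b := sigma i.+1.

Let aT : commute a T. Proof. exact: descend_far. Qed.
Let aba : (a * b * a = b * a * b)%g.
Proof. by apply: sigma_artin; exact: leq_trans mk. Qed.
Let loop_i : loop m i = (T * (b * (a * a) * b^-1) * T^-1)%g.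
Proof. by rewrite /loop (descendS im) invgM !mulgA. Qed.
Let loop_i1 : loop m i.+1 = (T * (b * b) * T^-1)%g. Proof. by []. Qed.

Lemma sigma_loop : (sigma i * loop m i = loop m i.+1 * sigma i)%g.
Proof.
have aTV : (T^-1 * a = a * T^-1)%g by apply/commute_sym/commuteV.
have e : (a * b * a * a * b^-1 = b * b * a)%g.
  by rewrite aba -(mulgA b a b) -(mulgA b (a * b)%g a) aba !mulgA mulgK.
rewrite loop_i loop_i1 -/a -[RHS]mulgA aTV !mulgA aT.
congr (_ * _)%g; rewrite -!mulgA; congr (_ * _)%g.
by move: e; rewrite !mulgA.
Qed.

(** Up to conjugation by [T] the product of the two adjacent loops is
    [b * a^2 * b], the full turn of the moving strand around both strands. *)
Lemma sigma_loop_prod : commute (sigma i) (loop m i * loop m i.+1)%g.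
Proof.
have -> : (loop m i * loop m i.+1 = T * (b * a * a * b) * T^-1)%g.
  by rewrite loop_i loop_i1 !mulgA !mulgVK.
apply: commute_shift aT _; rewrite /commute.
by rewrite !mulgA aba -!mulgA; do 2 congr (_ * _)%g; rewrite !mulgA aba.
Qed.

End AdjacentLoops.

(** The group [F_m] inside the whole braid group, where it can be conjugated by
    the Artin generators, which are not pure. *)
Definition strand_group m : set B :=
  [set b | moves m m m b /\ forall p, braid_end b p = p].

Lemma strand_group1 m : strand_group m 1%g.
Proof. by split=> [|p]; [exact: moves1|exact: braid_end1]. Qed.

Lemma strand_groupM m a b :
  strand_group m a -> strand_group m b -> strand_group m (a * b)%g.
Proof.
move=> [ma ea] [mb eb]; split=> [|p]; first exact: movesM ma mb.
by rewrite braid_endM ea eb.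
Qed.

Lemma strand_groupV m a : strand_group m a -> strand_group m a^-1%g.
Proof.
move=> [ma ea]; split=> [|p]; first exact: movesV.
by rewrite -{1}(ea p) braid_endK.
Qed.

Lemma strand_group_loop m j : m <= k.-1 -> j < m -> strand_group m (loop m j).
Proof. by move=> mk jm; split=> [|p]; [exact: loop_moves|exact: loop_end]. Qed.

(** On [F_m] an Artin generator acts by permuting the loops as it permutes the
    strands, up to inner conjugation. For the two adjacent strands, one of the
    loops goes to the other one by [sigma_loop], and the fate of the second is
    dictated by the invariance of their product, [sigma_loop_prod]. *)
Lemma conj_crossing_loop m i j c : m <= k.-1 -> i.+1 < m -> j < m ->
  exists2 g, strand_group m g &
    (crossing i c * loop m j * (crossing i c)^-1 = g * loop m (cross i j) * g^-1)%g.
Proof.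
move=> mk im jm.
have fixed : commute (sigma i) (loop m j) -> cross i j = j ->
    exists2 g, strand_group m g &
    (crossing i c * loop m j * (crossing i c)^-1 = g * loop m (cross i j) * g^-1)%g.
  move=> ij ->; exists 1%g; first exact: strand_group1.
  rewrite mul1g invg1 mulg1; suff -> : (crossing i c * loop m j = loop m j * crossing i c)%g.
    exact: mulgK.
  by rewrite /crossing; case: c => //; apply/commute_sym/commuteV.
have [ji|ij|ji] := ltngtP j i.
- by apply: fixed; [exact: sigma_loop_low|rewrite /cross !ltn_eqF // ltnW].
- move: (ij); rewrite leq_eqVlt => /orP[/eqP ji|{}ij]; last first.
    by apply: fixed; [exact: sigma_loop_high|rewrite /cross !gtn_eqF // ltnW].
  have -> : cross i j = i by rewrite -ji /cross eqxx gtn_eqF.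
  have Li := sigma_loop mk im; have Lii := sigma_loop_prod mk im; rewrite -ji.
  case: c fixed => _ /=; last first.
    exists 1%g; first exact: strand_group1.
    by rewrite invgK mul1g invg1 mulg1 -mulgA -Li mulKg.
  exists (loop m i.+1)^-1%g; first exact/strand_groupV/strand_group_loop.
  move: (loop m i) (loop m i.+1) Li Lii => x y Li Lii; rewrite invgK.
  apply: (@mulgI _ y); rewrite !mulgA mulgV mul1g -Li.
  by rewrite -(mulgA (sigma i)) Lii mulgK.
- have -> : cross i j = i.+1 by rewrite ji /cross eqxx.
  have Li := sigma_loop mk im; have Lii := sigma_loop_prod mk im; rewrite ji.
  case: c fixed => _ /=.
    exists 1%g; first exact: strand_group1.
    by rewrite mul1g invg1 mulg1 Li mulgK.
  exists (loop m i); first by apply: strand_group_loop => //; exact: ltnW.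
  move: (loop m i) (loop m i.+1) Li Lii => x y Li Lii; rewrite invgK.
  apply: (@mulgI _ (sigma i)); rewrite !mulgA mulgV mul1g.
  by rewrite -(mulgA (sigma i)) Lii -(mulgA x) -Li !mulgA mulgK.
Qed.

Lemma strand_group_conj m s f : m.+1 <= k.-1 -> below m s ->
  strand_group m.+1 f -> strand_group m.+1 (s * f * s^-1)%g.
Proof.
move=> mk ms; move: s ms f; apply: below_ind => [f|s i c im ik _ IH f Ff].
  by rewrite mul1g invg1 mulg1.
have -> : (s * crossing i c * f * (s * crossing i c)^-1 =
           s * (crossing i c * f * (crossing i c)^-1) * s^-1)%g.
  by rewrite invgM !mulgA.
apply: IH; move: f {Ff}(Ff.1); apply: moves_ind => //.
- by rewrite mulg1 mulgV; exact: strand_group1.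
- move=> x y Fx Fy; have := strand_groupM Fx Fy.
  by rewrite !mulgA mulgVK.
- by move=> x /strand_groupV; rewrite !invgM invgK !mulgA.
- move=> j jm; have [g Fg ->] := conj_crossing_loop c mk (im : i.+1 < m.+1) jm.
  apply: strand_groupM (strand_groupV Fg); apply: strand_groupM Fg _.
  by apply: strand_group_loop => //; rewrite ltnS cross_le.
Qed.

(** * Artin combing: existence *)

(** The braids [descend m.+1 q] represent the cosets of the braids on the first
    [m.+1] strands: multiplying one of them by a generator on the right gives
    the same or another one, up to a factor on the left that lies either in
    [F_m.+1] or among the braids on the first [m.+1] strands. *)
Lemma below_cosets m b : m.+1 <= k.-1 -> below m.+1 b ->
  exists f s q, [/\ strand_group m.+1 f, below m s, q <= m.+1
    & b = (f * s * descend m.+1 q)%g].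
Proof.
move=> mk; move: b; apply: below_ind => [|_ i c im ik _ [f [s [q [Ff ms qm ->]]]]].
  exists 1%g, 1%g, m.+1; rewrite descend_id !mulg1; split=> //.
    exact: strand_group1.
  exact: below1.
have crossing_below j : j < m -> below m (crossing j c).
  by rewrite /crossing => jm; case: c; [|apply: belowV]; exact: below_sigma.
(* Pushing [g] to the left of [s] conjugates it by [s], which keeps it in [F_m.+1]. *)
have absorb g r : strand_group m.+1 g -> r <= m.+1 ->
    (descend m.+1 q * crossing i c = g * descend m.+1 r)%g ->
    exists f' s' q', [/\ strand_group m.+1 f', below m s', q' <= m.+1
      & (f * s * descend m.+1 q * crossing i c = f' * s' * descend m.+1 q')%g].
  move=> Fg rm e; exists (f * (s * g * s^-1))%g, s, r; split=> //.
    by apply: strand_groupM Ff _; exact: strand_group_conj.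
  by rewrite -mulgA e !mulgA mulgVK.
have shift j : j < m ->
    (descend m.+1 q * crossing i c = crossing j c * descend m.+1 q)%g ->
    exists f' s' q', [/\ strand_group m.+1 f', below m s', q' <= m.+1
      & (f * s * descend m.+1 q * crossing i c = f' * s' * descend m.+1 q')%g].
  move=> jm e; exists f, (s * crossing j c)%g, q; split=> //.
    by apply: belowM ms _; exact: crossing_below.
  by rewrite -mulgA e !mulgA.
have [qi|iq|qi] := ltngtP q i.
- case: i im ik qi absorb shift => [//|i] im ik qi _ shift.
  apply: (shift i) => //; have e := descend_shift mk (qi : q <= i) im.
  rewrite /crossing; case: c {crossing_below shift}; first by rewrite e.
  by apply: (@mulgI _ (sigma i)); rewrite mulgA e mulgK mulVKg.
- move: (iq); rewrite leq_eqVlt => /orP[/eqP qi|{}iq]; last first.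
    apply: (shift i); first by rewrite -ltnS (leq_trans iq).
    have e := descend_far qm iq.
    by rewrite /crossing; case: (c); last apply: commuteV; apply: commute_sym => //.
  move: im absorb; rewrite -qi => im absorb.
  have := descendS im; case: c {crossing_below shift} absorb => absorb e.
    apply: (absorb 1%g i); [exact: strand_group1|exact: ltnW|].
    by rewrite mul1g e.
  apply: (absorb (loop m.+1 i)^-1%g i); [|exact: ltnW|].
    exact/strand_groupV/strand_group_loop.
  by rewrite e /loop !invgM invgK !mulgA mulgVK mulgVK.
- move: qm absorb; rewrite qi => _ absorb.
  have := descendS im; case: c {crossing_below shift} absorb => absorb e.
    apply: (absorb (loop m.+1 i) i.+1) => //; first exact: strand_group_loop.
    by rewrite e /loop mulgVK !mulgA.
  apply: (absorb 1%g i.+1) => //; first exact: strand_group1.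
  by rewrite mul1g e mulgK.
Qed.

(** A pure braid lies in the coset of the trivial path, as [descend m.+1 q] sends
    the strand [m.+1] to [q] and the two other factors fix it. *)
Lemma comb_step m b : m.+1 <= k.-1 -> below m.+1 b ->
  (forall p, braid_end b p = p) ->
  exists f s, [/\ strand_group m.+1 f, below m s & b = (f * s)%g].
Proof.
move=> mk mb eb; have [f [s [q [Ff ms qm eq_b]]]] := below_cosets mk mb.
exists f, s; split=> //.
have [w [dq _ _ wq]] := descend_moves mk qm.
have q_m : q = m.+1.
  move: (eb m.+1); rewrite eq_b !braid_endM Ff.2 (below_end_gt ms) //.
  by rewrite dq braid_end_class wq.
by rewrite eq_b q_m descend_id mulg1.
Qed.

End ArtinGenerators.

(** * Artin combing: uniqueness *)

Section ForgetStrand.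
Variable k : nat.
Local Open Scope nat_scope.
Implicit Types (u v w : braid_word k) (p : nat).

Definition skip_index p (i : 'I_k.-1) : 'I_k.-1 :=
  if i < p then i else Ordinal (leq_ltn_trans (leq_pred i) (ltn_ord i)).

(** Deletes the strand starting at [p] and adds a trivial strand on the right, so
    that the result is a braid word on the same number of strands. *)
Fixpoint forget p w : braid_word k :=
  if w is l :: w' then
    (if (p == val l.1) || (p == (val l.1).+1) then [::]
     else [:: (skip_index p l.1, l.2)]) ++ forget (cross (val l.1) p) w'
  else [::].

Lemma forget_consL (i : 'I_k.-1) c w : forget i ((i, c) :: w) = forget i.+1 w.
Proof. by rewrite /= /cross eqxx. Qed.

Lemma forget_consR (i : 'I_k.-1) c w : forget i.+1 ((i, c) :: w) = forget i w.
Proof. by rewrite /= /cross eqxx orbT gtn_eqF. Qed.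

Lemma forget_consN p (i : 'I_k.-1) c w : p <> i -> p <> i.+1 ->
  forget p ((i, c) :: w) = (skip_index p i, c) :: forget p w.
Proof. by move=> /eqP/negPf n1 /eqP/negPf n2; rewrite /= /cross n1 n2. Qed.

Lemma forget_cat p u v :
  forget p (u ++ v) = forget p u ++ forget (strand_end u p) v.
Proof. by elim: u p => //= l u IH p; rewrite IH catA. Qed.

Lemma forget_only_moves p w : only_moves p w -> forget p w = [::].
Proof. by elim: w p => //= l w IH p /andP[-> /IH ->]. Qed.

Lemma skip_index_lt p (i : 'I_k.-1) : i < p -> skip_index p i = i.
Proof. by rewrite /skip_index => ->. Qed.

Lemma skip_indexE p (i : 'I_k.-1) :
  skip_index p i = (if i < p then i : nat else i.-1) :> nat.
Proof. by rewrite /skip_index; case: ifP. Qed.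

Lemma forget_below m w : all (fun l => val l.1 < m) w -> forget m.+1 w = w.
Proof.
elim: w => // -[i c] w IH /andP[im /IH wm].
by rewrite forget_consN ?wm ?skip_index_lt //; move: im => /=; lia.
Qed.

Lemma forget_equiv u v : braid_equiv u v ->
  forall p, braid_equiv (forget p u) (forget p v).
Proof.
elim=> {u v}.
- by move=> u p; exact: BraidRefl.
- by move=> u v _ IH p; apply: BraidSym.
- by move=> u v w _ IH1 _ IH2 p; apply: BraidTrans (IH1 p) (IH2 p).
- move=> u u' v v' uu' IH1 _ IH2 p; rewrite !forget_cat (strand_end_equiv uu' p).
  by apply: BraidCat.
- move=> i b p; case: (p =P i) => [->|p1].
    by rewrite forget_consL forget_consR; exact: BraidRefl.
  case: (p =P i.+1) => [->|p2].
    by rewrite forget_consR forget_consL; exact: BraidRefl.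
  by rewrite !forget_consN //; exact: BraidCancel.
- move=> i j ij p.
  have skipE q r : (j < q) = (j < r) -> skip_index q j = skip_index r j.
    by move=> e; apply: val_inj; rewrite /= !skip_indexE e.
  have skipE' q r : (i < q) = (i < r) -> skip_index q i = skip_index r i.
    by move=> e; apply: val_inj; rewrite /= !skip_indexE e.
  case: (p =P i) => [->|p1].
    rewrite forget_consL !(@forget_consN _ j) ?forget_consL; try lia.
    by rewrite (skipE i.+1 i); [exact: BraidRefl|lia].
  case: (p =P i.+1) => [->|p2].
    rewrite forget_consR !(@forget_consN _ j) ?forget_consR; try lia.
    by rewrite (skipE i.+1 i); [exact: BraidRefl|lia].
  case: (p =P j) => [->|p3].
    rewrite forget_consL !(@forget_consN _ i) ?forget_consL; try lia.
    by rewrite (skipE' j.+1 j); [exact: BraidRefl|lia].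
  case: (p =P j.+1) => [->|p4].
    rewrite forget_consR !(@forget_consN _ i) ?forget_consR; try lia.
    by rewrite (skipE' j.+1 j); [exact: BraidRefl|lia].
  rewrite !forget_consN //; apply: BraidFar; rewrite /= !skip_indexE.
  by case: ifP; case: ifP; lia.
- move=> i j ji p.
  have skip_ij q r : i < q -> r <= j -> skip_index q i = skip_index r j.
    move=> iq rj; apply: val_inj; rewrite /= !skip_indexE.
    by do 2 case: ifP; lia.
  case: (p =P i) => [->|p1].
    rewrite forget_consL -ji forget_consL forget_consN; try lia.
    rewrite (@forget_consN i j); try lia.
    rewrite forget_consL -ji forget_consL.
    by rewrite (skip_ij _ i); [exact: BraidRefl|lia|lia].
  case: (p =P i.+1) => [->|p2].
    rewrite forget_consR (@forget_consN i j); try lia.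
    rewrite forget_consL -ji forget_consL forget_consN; try lia.
    rewrite forget_consR.
    by rewrite (skip_ij _ i); [exact: BraidRefl|lia|lia].
  case: (p =P j.+1) => [->|p3].
    rewrite forget_consN; try lia.
    rewrite !forget_consR ji !forget_consR (@forget_consN i j); try lia.
    by rewrite (skip_ij _ i); [exact: BraidRefl|lia|lia].
  rewrite !forget_consN //; try lia; apply: BraidArtin; rewrite /= !skip_indexE.
  by case: ifP; case: ifP; lia.
Qed.

(** Forgetting the strand [m.+1] kills [a] and [b], in which no other strand
    moves, and leaves [s] and [t] unchanged. *)
Lemma comb_factor_inj m a b s t : moves m.+1 m.+1 m.+1 a ->
  moves m.+1 m.+1 m.+1 b -> below m s -> below m t ->
  (a * s = b * t)%g -> s = t :> braid k.
Proof.
move=> [u [-> mu _ eu]] [v [-> mv _ ev]] [s' -> sm] [t' -> tm].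
rewrite -!braid_class_cat => /braid_classP/forget_equiv/(_ m.+1).
rewrite !forget_cat (forget_only_moves mu) (forget_only_moves mv) eu ev.
rewrite (forget_below sm) (forget_below tm) => e.
exact/braid_classP.
Qed.

End ForgetStrand.

(** * The combing map is bijective *)

Section CombProd.
Variable k : nat.
Local Open Scope nat_scope.

Lemma braid_end_pure (b : pure_braid k) p : braid_end (val b) p = p.
Proof.
by rewrite -[val b]braid_classK braid_end_class (strand_end_pure (esym (braid_classK (val b)))).
Qed.

Lemma pure_braidP (b : braid k) : (forall p, braid_end b p = p) ->
  exists c : pure_braid k, val c = b.
Proof.
move=> eb; suff pb : b \in @is_pure k by exists (exist _ b pb).
rewrite -(braid_classK b); apply/is_pureP => p.
by rewrite -braid_end_class braid_classK.
Qed.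

Lemma val_free_part m (f : free_part k m) : strand_group m (val (val f)).
Proof.
split=> [|p]; last exact: braid_end_pure.
have /asboolP[w [fw mw wm]] := valP f; exists w; split=> //.
exact: strand_end_pure fw m.
Qed.

Lemma free_partP m (b : braid k) : strand_group m b ->
  exists f : free_part k m, val (val f) = b.
Proof.
move=> [[w [bw mw wm _]] /pure_braidP[c cb]].
suff cF : c \in @in_free k m by exists (exist _ c cF).
by apply/asboolP; exists w; rewrite cb.
Qed.

Lemma val_comb_prodS m (f : free_part k m.+1) (x : free_prod k m) :
  val (@comb_prod k m.+1 (f, x)) = (val (val f) * val (comb_prod x))%g.
Proof. by []. Qed.

Lemma below_comb_prod m (x : free_prod k m) : below m (val (comb_prod x)).
Proof.
elim: m x => [|m IH] x; first exact: below1.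
case: x => f x; rewrite val_comb_prodS; apply: belowM.
  by have [[w [-> _ wm _]] _] := val_free_part f; exists w.
exact: below_le (leqnSn m) (IH x).
Qed.

Lemma comb_prod_inj m : injective (@comb_prod k m).
Proof.
elim: m => [|m IH]; first by case; case.
move=> [f x] [f' x'] /(congr1 val); rewrite !val_comb_prodS => e.
have xx : x = x'.
  apply/IH/val_inj.
  exact: (comb_factor_inj (val_free_part f).1 (val_free_part f').1
           (below_comb_prod x) (below_comb_prod x') e).
by move: e; rewrite xx => /mulIg/val_inj/val_inj ->.
Qed.

Lemma comb_prod_surj m (b : pure_braid k) : m <= k.-1 -> below m (val b) ->
  exists x, @comb_prod k m x = b.
Proof.
elim: m b => [|m IH] b mk mb.
  exists tt; apply: val_inj; case: mb => -[|l w]; first by move=> ->.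
  by move=> _ /andP[].
have [f [s [Ff ms bE]]] := comb_step mk mb (braid_end_pure b).
have [g gf] := free_partP Ff.
have [c cs] : exists c : pure_braid k, val c = s.
  apply: pure_braidP => p; rewrite -[RHS](braid_end_pure b) bE braid_endM.
  by rewrite Ff.2.
have [|x xc] := IH c (ltnW mk); first by rewrite cs.
by exists (g, x); apply: val_inj; rewrite val_comb_prodS xc gf cs.
Qed.

Lemma below_all (b : braid k) : below k.-1 b.
Proof.
exists (repr b); first by rewrite braid_classK.
by apply/allP => l _; exact: ltn_ord.
Qed.

Lemma combingK : cancel (@combing k) (@comb_prod k k.-1).
Proof.
move=> b; have [x xb] := comb_prod_surj (leqnn _) (below_all (val b)).
exact: (@xgetPex _ 1%g [set x : Pi k | comb_prod x = b]) (ex_intro _ x xb).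
Qed.

Lemma comb_prodK : cancel (@comb_prod k k.-1) (@combing k).
Proof. by move=> x; apply: comb_prod_inj; rewrite combingK. Qed.

End CombProd.

(** * Pure braids act trivially on the abelianised free factors *)

Section ModSquare.
Variables (R : pzRingType) (H : groupType).
Local Notation "[ h ]" := (gr_elt R h).
Local Notation J2 := (augmentation_power R H 2).
Implicit Types (f g h : H).

Lemma aug_pow2_trans f g h : J2 ([f] - [g]) -> J2 ([g] - [h]) -> J2 ([f] - [h]).
Proof. by move=> fg gh; rewrite -(subrKA [g]); exact: aug_powD. Qed.

Lemma aug_pow2_mul f g f' g' : J2 ([f] - [f']) -> J2 ([g] - [g']) ->
  J2 ([f * g]%g - [f' * g']%g).
Proof.
move=> Jf Jg; rewrite !gr_eltM -(subrKA ([f] * [g'])) -mulrBr -mulrBl.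
by apply: aug_powD; [exact: aug_powMl|exact: aug_powMr].
Qed.

Lemma aug_pow2_inv f g : J2 ([f] - [g]) -> J2 ([f^-1]%g - [g^-1]%g).
Proof.
move=> fg; have -> : [f^-1]%g - [g^-1]%g = - ([f^-1]%g * ([f] - [g]) * [g^-1]%g).
  rewrite mulrBr mulrBl -!gr_eltM -opprB mulVg mul1g; congr (- (_ - _)).
  by rewrite -mulgA mulgV mulg1.
by apply/aug_powN/aug_powMr/aug_powMl.
Qed.

(** [g * h - h * g = (g - 1) * (h - 1) - (h - 1) * (g - 1)] in the group ring. *)
Lemma aug_pow2_conj g h : J2 ([g * h * g^-1]%g - [h]).
Proof.
have -> : [g * h * g^-1]%g - [h] =
    (([g] - 1) * ([h] - 1) - ([h] - 1) * ([g] - 1)) * [g^-1]%g.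
  have -> : ([g] - 1) * ([h] - 1) - ([h] - 1) * ([g] - 1) = [g] * [h] - [h] * [g].
    have e (x y : group_ring R H) : (x - 1) * (y - 1) = x * y - (x + y - 1).
      by rewrite mulrBl mul1r mulrBr mulr1 -addrA -opprD addrA.
    by rewrite !e (addrC [h]); move: ([g] + [h] - 1) => c; rewrite opprB addrA subrK.
  by rewrite mulrBl -!gr_eltM mulgK.
apply: aug_powMr; apply: aug_powD; last apply: aug_powN;
  by apply: (@aug_powM _ _ 1 1); exact: aug_pow_elt1.
Qed.

End ModSquare.

Section ConjugationAction.
Variables (R : pzRingType) (k m : nat).
Local Open Scope nat_scope.
Implicit Types (a b : braid k).

(** Congruence in the abelianisation of [F_m], stated for elements of the braid
    group because the conjugating braids lie outside [F_m] and need not be pure. *)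
Definition cong_square a b := exists f g : free_part k m,
  [/\ val (val f) = a, val (val g) = b
    & augmentation_power R (free_part k m) 2 (gr_elt R f - gr_elt R g)%R].

Lemma cong_square_refl a : strand_group m a -> cong_square a a.
Proof.
by move=> /free_partP[f fa]; exists f, f; rewrite subrr; split=> //; exact: aug_pow0.
Qed.

Lemma val_free_part_inj (f g : free_part k m) : val (val f) = val (val g) -> f = g.
Proof. by move=> /val_inj/val_inj. Qed.

Lemma cong_square_trans a b c :
  cong_square a b -> cong_square b c -> cong_square a c.
Proof.
move=> [f [g [fa gb fg]]] [g' [h [gb' hc gh]]]; exists f, h; split; [exact: fa|exact: hc|].
have gg := val_free_part_inj (etrans gb' (esym gb)); rewrite gg in gh.
exact: (aug_pow2_trans fg gh).
Qed.

Lemma cong_squareM a b a' b' : cong_square a a' -> cong_square b b' ->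
  cong_square (a * b)%g (a' * b')%g.
Proof.
move=> [f [f' [<- <- ff]]] [g [g' [<- <- gg]]]; exists (f * g)%g, (f' * g')%g.
by split; [exact: erefl|exact: erefl|exact: (aug_pow2_mul ff gg)].
Qed.

Lemma cong_squareV a b : cong_square a b -> cong_square a^-1%g b^-1%g.
Proof.
by move=> [f [g [<- <- fg]]]; exists f^-1%g, g^-1%g; split; [| |exact: aug_pow2_inv].
Qed.

Lemma cong_square_conj a b : strand_group m a -> strand_group m b ->
  cong_square (a * b * a^-1)%g b.
Proof.
move=> /free_partP[f <-] /free_partP[g <-]; exists (f * g * f^-1)%g, g.
by split; [exact: erefl|exact: erefl|exact: (aug_pow2_conj R f g)].
Qed.

End ConjugationAction.

Section PureAction.
Variables (R : pzRingType) (k m : nat).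
Local Open Scope nat_scope.
Hypothesis mk : m.+1 <= k.-1.

(** Each generator permutes the loops up to conjugation by [F_m.+1], so a braid
    permutes them, modulo the square of the augmentation ideal, according to its
    permutation of the strands. *)
Lemma conj_loop (s : braid k) p : below m s -> p < m.+1 ->
  cong_square R m.+1 (s * loop k m.+1 (braid_end s p) * s^-1)%g (loop k m.+1 p).
Proof.
move=> Hs pm; move: s Hs; apply: below_ind => [|s i c im ik ms IH].
  rewrite mul1g invg1 mulg1 braid_end1.
  exact/cong_square_refl/strand_group_loop.
rewrite braid_endM braid_end_crossing //; set q := braid_end s p in IH *.
have qm : q < m.+1 by rewrite ltnS below_end_le.
have cqm : cross i q < m.+1 by rewrite ltnS cross_le.
have [g Fg e] := conj_crossing_loop c mk (im : i.+1 < m.+1) cqm.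
have -> : (s * crossing k i c * loop k m.+1 (cross i q) * (s * crossing k i c)^-1 =
    (s * g * s^-1) * (s * loop k m.+1 q * s^-1) * (s * g * s^-1)^-1)%g.
  move: e; rewrite crossK.
  move: (loop _ _ (cross i q)) (loop _ _ q) (crossing k i c) => L L' x e.
  have -> : (s * x * L * (s * x)^-1 = s * (x * L * x^-1) * s^-1)%g.
    by rewrite invgM !mulgA.
  by rewrite e !invgM !invgK !mulgA !mulgVK.
apply: cong_square_trans IH; apply: cong_square_conj; apply: strand_group_conj => //.
exact: strand_group_loop.
Qed.

(** A pure braid permutes the loops trivially by [conj_loop], and they generate
    [F_m.+1]. *)
Lemma conj_pure (s f : braid k) : below m s -> (forall p, braid_end s p = p) ->
  strand_group m.+1 f -> cong_square R m.+1 (s * f * s^-1)%g f.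
Proof.
move=> ms es [Ff _]; move: f Ff; apply: moves_ind => //.
- by rewrite mulg1 mulgV; exact/cong_square_refl/strand_group1.
- move=> a b Ha Hb; have := cong_squareM Ha Hb.
  by rewrite !mulgA mulgVK.
- by move=> a /cong_squareV; rewrite !invgM invgK mulgA.
- by move=> j jm; have := conj_loop ms jm; rewrite es.
Qed.

Lemma trivial_mod_square_comb_prod (x : free_prod k m) :
  trivial_mod_square R (val : free_part k m.+1 -> pure_braid k) (comb_prod x).
Proof.
move=> h; have [f [g [fE gE fg]]] := conj_pure (below_comb_prod x)
  (braid_end_pure (comb_prod x)) (val_free_part h).
have fh : val f = (comb_prod x * val h * (comb_prod x)^-1)%g by apply: val_inj.
rewrite (val_free_part_inj gE) in fg.
exists (gr_elt R f - gr_elt R h)%R; first exact: fg.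
apply: etrans (linear_extensionB _ (gr_elt R f) (gr_elt R h)) _.
congr (_ - _)%R; last exact: linear_extension_elt.
by rewrite -fh; exact: linear_extension_elt.
Qed.

End PureAction.

(** * Combing and the powers of the augmentation ideal *)

Section CombingAugmentation.
Variables (R : pzRingType) (k : nat).
Local Open Scope nat_scope.
Local Notation comb_image m n :=
  (linear_extension R (@comb_prod k m) @` augmentation_power R (free_prod k m) n).

(** The hypotheses of [almost_direct_product_step] for [F_m.+1] are the triviality
    of the action and this same property for the smaller factors. *)
Lemma comb_image_step m n (x : free_prod k m) z : m <= k.-1 ->
  comb_image m n z -> comb_image m n.+1 ((gr_elt R (comb_prod x) - 1) * z)%R.
Proof.
elim: m n x z => [|m IH] n x z mk Mz.
  rewrite gr_elt1 subrr mul0r; exists 0%R; last exact: linear_extension0.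
  exact: aug_pow0.
case: x => h x; apply: almost_direct_product_step Mz.
- exact: valM.
- by move=> j y; apply: IH; exact: ltnW.
- exact: trivial_mod_square_comb_prod.
Qed.

Lemma comb_image_sub m n : comb_image m n `<=` augmentation_power R (pure_braid k) n.
Proof.
elim: m n => [|m IH] n.
  move=> _ [a Ja <-]; apply: linear_extension_aug_pow => // x y.
  by rewrite /= mulg1.
move=> z Mz; have : filtered_mul
    (fun i => linear_extension R (val : free_part k m.+1 -> pure_braid k) @`
                augmentation_power R (free_part k m.+1) i)
    (fun j => comb_image m j) n z.
  by rewrite -linear_extension_prod_aug_pow.
apply: filtered_mul_additive_ind; [exact: aug_pow0|exact: aug_powD|].
move=> i j x y <- [a Ja <-] Dy; apply: aug_powM; last exact: IH.
by apply: linear_extension_aug_pow => //; exact: valM.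
Qed.

Lemma combing_linK : cancel (linear_extension R (@combing k))
  (linear_extension R (@comb_prod k k.-1)).
Proof.
by move=> x; rewrite linear_extension_comp; apply: linear_extension_id; exact: combingK.
Qed.

Lemma comb_prod_linK : cancel (linear_extension R (@comb_prod k k.-1))
  (linear_extension R (@combing k)).
Proof.
by move=> x; rewrite linear_extension_comp; apply: linear_extension_id; exact: comb_prodK.
Qed.

Lemma comb_imageE n :
  comb_image k.-1 n = augmentation_power R (pure_braid k) n.
Proof.
apply/seteqP; split; first exact: comb_image_sub.
apply: (@aug_pow_sub _ _ (fun n => comb_image k.-1 n)).
- by move=> x; exists (linear_extension R (@combing k) x) => //; exact: combing_linK.
- by move=> m; exists 0%R; [exact: aug_pow0|exact: linear_extension0].
- move=> m _ _ [a Ja <-] [b Jb <-]; exists (a + b)%R; first exact: aug_powD.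
  exact: linear_extensionD.
- move=> m c _ [a Ja <-]; exists (gr_const (Pi k) c * a)%R; first exact: aug_powMl.
  exact: linear_extension_const.
by move=> m g x Mx; rewrite -(combingK g); exact: comb_image_step.
Qed.

End CombingAugmentation.

Theorem theorem2 (R : comPzRingType) (k : nat) (hk : (1 <= k)%N) (n : nat) :
  linear_extension R (@combing k) @` augmentation_power R (pure_braid k) n
    = augmentation_power R (Pi k) n
  /\ set_bij (augmentation_power R (pure_braid k) n)
       (augmentation_power R (Pi k) n) (linear_extension R (@combing k)).
Proof.
have image : linear_extension R (@combing k) @` augmentation_power R (pure_braid k) n
    = augmentation_power R (Pi k) n.
  rewrite -(comb_imageE R k n); apply/seteqP; split.
    by move=> _ [_ [x Jx <-] <-]; rewrite comb_prod_linK.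
  move=> x Jx; exists (linear_extension R (@comb_prod k k.-1) x); first by exists x.
  exact: comb_prod_linK.
split=> //; split.
- by move=> x Jx; rewrite /= -image; exists x.
- by move=> x y _ _ /(can_inj (@combing_linK R k)).
- by rewrite -image.
Qed.
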